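(* Let $p\in\mathcal{H}$ with $p(0)=1$, let $$\varphi_0(z):=1+\frac{z}{k}\left(\frac{k+z}{k-z}\right),\qquad k=\sqrt{2}+1,\ z\in\mathbb{D},$$ let $\varphi_{Ne}(z):=1+z-z^3/3$, and let $\beta\in\mathbb{R}$. If any one of the following differential subordinations holds, then $p\prec\varphi_{Ne}$: (a) $1+\beta zp'(z)\prec\varphi_0(z)$, for $\beta\geq3\log\left(1+\dfrac{1}{\sqrt{2}}\right)-\dfrac32\left(\sqrt{2}-1\right)\approx0.98308$; (b) $1+\beta\,\dfrac{zp'(z)}{p(z)}\prec\varphi_0(z)$, for $\beta\geq\dfrac{2\left(\log\left(\frac{1+\sqrt{2}}{\sqrt{2}}\right)-\frac{1}{2(1+\sqrt{2})}\right)}{\log(5/3)}\approx1.28299$; (c) $1+\beta\,\dfrac{zp'(z)}{p^2(z)}\prec\varphi_0(z)$, for $\beta\geq5\left(\log\left(\dfrac{1+\sqrt{2}}{\sqrt{2}}\right)-\dfrac{1}{2(1+\sqrt{2})}\right)\approx1.63847$. Each of the respective bounds on $\beta$ is best possible.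
   Context: $\mathbb{D}=\{z\in\mathbb{C}:|z|<1\}$ and $\mathcal{H}$ is the set of all analytic functions on $\mathbb{D}$. For $f,g\in\mathcal{H}$, $f\prec g$ ($f$ is subordinate to $g$) means that there is $w\in\mathcal{H}$ with $w(0)=0$ and $|w(z)|<1$ for $z\in\mathbb{D}$ such that $f(z)=g(w(z))$ on $\mathbb{D}$; in particular, writing a subordination presupposes that both sides are analytic in $\mathbb{D}$. $\log$ of a positive number is the natural logarithm. That a bound $\beta\ge\beta_0$ is best possible means that $\beta_0$ cannot be replaced by any smaller real number so that the implication remains valid for all such $p$ and all $\beta$ at least that number. *)

(* Defs.v *)
From Stdlib Require Export Reals.
From Coquelicot Require Export Coquelicot.
Open Scope R_scope.

Definition unit_disk (z : C) : Prop := Cmod z < 1.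

(* Functions on the disk are total functions [C -> C]; only their values on the
   disk matter, since it is open. Analytic means complex differentiable. *)
Definition analytic_disk (f : C -> C) : Prop :=
  forall z : C, unit_disk z ->
    ex_derive (K := C_AbsRing) (V := C_NormedModule) f z.

Definition subordinate (f g : C -> C) : Prop :=
  analytic_disk f /\ analytic_disk g /\
  exists w : C -> C,
    analytic_disk w /\ w (RtoC 0) = RtoC 0 /\
    (forall z : C, unit_disk z -> Cmod (w z) < 1) /\
    (forall z : C, unit_disk z -> f z = g (w z)).

Definition k0 : R := sqrt 2 + 1.

Definition phi0 (z : C) : C := (1 + z / k0 * ((k0 + z) / (k0 - z)))%C.

Definition phiNe (z : C) : C := (1 + z - z ^ 3 / 3)%C.

Definition lhs_a (beta : R) (p : C -> C) (z : C) : C :=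
  (1 + beta * (z * C_derive p z))%C.

(* Division in [C] is total. In [lhs_b] and [lhs_c] its value at a zero of [p]
   is harmless: for [beta <> 0] and [p] analytic with [p 0 = 1], these
   functions have a pole at each zero of [p] in the disk, so whatever value they
   take there they can be analytic on the disk, as [subordinate] requires, only
   if [p] has no zero in it. *)
Definition lhs_b (beta : R) (p : C -> C) (z : C) : C :=
  (1 + beta * (z * C_derive p z / p z))%C.

Definition lhs_c (beta : R) (p : C -> C) (z : C) : C :=
  (1 + beta * (z * C_derive p z / p z ^ 2))%C.

Definition beta_a : R := 3 * ln (1 + 1 / sqrt 2) - 3 / 2 * (sqrt 2 - 1).

Definition beta_b : R :=
  2 * (ln ((1 + sqrt 2) / sqrt 2) - 1 / (2 * (1 + sqrt 2))) / ln (5 / 3).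

Definition beta_c : R :=
  5 * (ln ((1 + sqrt 2) / sqrt 2) - 1 / (2 * (1 + sqrt 2))).

(* The implication is valid for all [p] and all [beta >= b]. *)
Definition valid_from (lhs : R -> (C -> C) -> C -> C) (b : R) : Prop :=
  forall (p : C -> C) (beta : R),
    analytic_disk p -> p (RtoC 0) = RtoC 1 -> b <= beta ->
    subordinate (lhs beta p) phi0 -> subordinate p phiNe.

Definition best_possible (lhs : R -> (C -> C) -> C -> C) (b0 : R) : Prop :=
  forall b : R, b < b0 -> ~ valid_from lhs b.

(* Main.v *)
(* The cubic [o - o^3 / 3] maps the unit disk onto a region containing the disk of
   radius 2/3, and its inverse there is a fixed point of the contraction
   [o |-> u + o^3 / 3]; hence [p] is subordinate to [phiNe] as soon as
   [|p - 1| < 2/3].  By the Schwarz lemma, [phi0 (w z) - 1] is dominated by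
   [|z| H' |z|] with [H r = - r / k0 - 2 ln (1 - r / k0)], and [H 1] is [2/3], [ln (5/3)]
   and [2/5] times the bounds in (a), (b), (c).  Integrating along rays from [0] gives
   [|p - 1| <= H |z| / beta] in (a), [|p - 1| <= exp (H |z| / beta) - 1] in (b) and
   [|1 / p - 1| <= H |z| / beta] in (c), which is [|p - 1| < 2/3] in each case.  The functions
   [1 + H / beta], [exp (H / beta)] and [1 / (1 - H / beta)] show that the bounds are sharp:
   for [beta] slightly below them they exceed 5/3 at a point of the real axis, and [phiNe]
   takes no real value [>= 5/3] on the disk. *)
Require Import Defs.
From Stdlib Require Import Lia Psatz Classical IndefiniteDescription.

(** * Complex differentiability and curves *)

(** The Schwarz lemma is the analytic core. Its usual proof applies the maximum principle to
    [w z / z], which requires removing the singularity at [0]. Here Goursat's theorem on a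
    rectangle, transported by the exponential, only bounds the derivative at [0] of a bounded map
    fixing [0]; Moebius maps carry this bound to every point (Schwarz-Pick), and integrating the
    resulting differential inequality along a ray returns the bound on [w z] itself. The second
    obstacle is that the estimates in (b) and (c) make sense only where [p] has no zero. Along each
    ray they are therefore used first to bound [p] away from [0] up to a hypothetical first zero,
    and only then on the whole ray. The number 2/3 is the minimum of [|o - o^3/3|] on the unit
    circle, attained at [o = 1], where [phiNe] takes the value 5/3. So the disk of radius 2/3 about
    1 touches the boundary of the image exactly at the point reached by the extremal functions, and
    this is why a mere disk gives sharp constants. *)

Definition is_cderive (f : C -> C) (z l : C) : Prop :=
  is_derive (K := C_AbsRing) (V := C_NormedModule) f z l.

Lemma Cplus_minus_cancel (a b : C) : (a + (b - a))%C = b.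
Proof. ring. Qed.

Lemma is_cderive_iff (f : C -> C) (z l : C) :
  is_cderive f z l <->
  forall eps, 0 < eps -> exists delta, 0 < delta /\
    forall h, Cmod h < delta ->
      Cmod (f (z + h) - f z - h * l)%C <= eps * Cmod h.
Proof.
  split.
  - intros [_ H] eps Heps.
    destruct (H z (fun P HP => HP) (mkposreal eps Heps)) as [d Hd].
    exists d; split; [apply cond_pos|]. intros h Hh.
    specialize (Hd (z + h)%C).
    assert (E : minus (z + h)%C z = h) by (change ((z + h + - z)%C = h); ring).
    assert (Hb : Cmod (minus (z + h)%C z) < d) by now rewrite E.
    specialize (Hd Hb).
    change (Cmod (minus (minus (f (z + h)%C) (f z)) (scal (minus (z + h)%C z) l))
      <= eps * Cmod (minus (z + h)%C z)) in Hd.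
    rewrite E in Hd. exact Hd.
  - intros H. split.
    + apply is_linear_scal_l.
    + intros x Hx.
      assert (Ex : z = x) by exact (@is_filter_lim_locally_unique C_AbsRing (AbsRing_NormedModule C_AbsRing) z x Hx).
      subst x. intros [eps Heps].
      destruct (H eps Heps) as (d & Hd0 & Hd).
      exists (mkposreal d Hd0). intros y Hy.
      change (Cmod (minus y z) < d) in Hy.
      change (Cmod (minus (minus (f y) (f z)) (scal (minus y z) l))
      <= eps * Cmod (minus y z)).
      specialize (Hd _ Hy).
      replace (z + minus y z)%C with y in Hd
        by exact (eq_sym (Cplus_minus_cancel z y)).
      exact Hd.
Qed.

(** [C_NormedModule] and the module that [C] forms over itself as an absolute ring are distinct
    structures, and the rules for the identity, for products and for inner functions refer to the
    second one. The differential estimates are convertible; only linearity is proved anew. *)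
Lemma is_cderive_ring (f : C -> C) (z l : C) :
  is_cderive f z l <->
  @is_derive C_AbsRing (AbsRing_NormedModule C_AbsRing) f z l.
Proof.
  split; intros [L H]; split.
  - apply (is_linear_scal_l (K := C_AbsRing) (V := AbsRing_NormedModule C_AbsRing)).
  - exact H.
  - apply is_linear_scal_l.
  - exact H.
Qed.

Lemma is_cderive_eq (f : C -> C) (z l l' : C) :
  is_cderive f z l -> l = l' -> is_cderive f z l'.
Proof. now intros H <-. Qed.

Lemma is_cderive_const (c z : C) : is_cderive (fun _ => c) z 0%C.
Proof. exact (is_derive_const (K := C_AbsRing) (V := C_NormedModule) c z). Qed.

Lemma is_cderive_id (z : C) : is_cderive (fun y => y) z 1%C.
Proof.
  apply is_cderive_ring. exact (is_derive_id (K := C_AbsRing) z).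
Qed.

Lemma is_cderive_plus (f g : C -> C) (z l m : C) :
  is_cderive f z l -> is_cderive g z m ->
  is_cderive (fun y => f y + g y)%C z (l + m)%C.
Proof. exact (@is_derive_plus C_AbsRing C_NormedModule f g z l m). Qed.

Lemma is_cderive_minus (f g : C -> C) (z l m : C) :
  is_cderive f z l -> is_cderive g z m ->
  is_cderive (fun y => f y - g y)%C z (l - m)%C.
Proof. exact (@is_derive_minus C_AbsRing C_NormedModule f g z l m). Qed.

Lemma is_cderive_mult (f g : C -> C) (z l m : C) :
  is_cderive f z l -> is_cderive g z m ->
  is_cderive (fun y => f y * g y)%C z (l * g z + f z * m)%C.
Proof.
  intros H1 H2. apply is_cderive_ring. apply is_cderive_ring in H1, H2.
  apply (@is_derive_mult C_AbsRing f g z l m H1 H2). exact Cmult_comm.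
Qed.

Lemma is_cderive_comp (f g : C -> C) (z l m : C) :
  is_cderive f (g z) l -> is_cderive g z m ->
  is_cderive (fun y => f (g y)) z (m * l)%C.
Proof.
  intros H1 H2. apply is_cderive_ring in H2.
  exact (@is_derive_comp C_AbsRing C_NormedModule f g z l m H1 H2).
Qed.

Lemma is_cderive_ext_loc (f g : C -> C) (z l : C) (d : R) :
  0 < d -> (forall y, Cmod (y - z)%C < d -> f y = g y) ->
  is_cderive f z l -> is_cderive g z l.
Proof.
  intros Hd E. apply (@is_derive_ext_loc C_AbsRing C_NormedModule).
  exists (mkposreal d Hd). exact E.
Qed.

Lemma Cmod_minus_le (a b : C) : Cmod a - Cmod b <= Cmod (a - b)%C.
Proof.
  pose proof (Cmod_triangle (a - b) b).
  replace (a - b + b)%C with a in H by ring. lra.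
Qed.

Lemma Cmod_minus_sym (a b : C) : Cmod (a - b)%C = Cmod (b - a)%C.
Proof. rewrite <- Cmod_opp. f_equal. ring. Qed.

Lemma Cmod_neq_0 (z : C) : z <> 0%C -> 0 < Cmod z.
Proof. apply Cmod_gt_0. Qed.

Lemma is_cderive_inv (z : C) : z <> 0%C -> is_cderive Cinv z (- / (z * z))%C.
Proof.
  intros Hz. apply is_cderive_iff. intros eps Heps.
  pose proof (Cmod_neq_0 z Hz) as Hz0. set (r := Cmod z) in *.
  (* The remainder equals [h^2 / (z^2 (z + h))]. The first bound keeps [|z + h|] above [r / 2], the
     second then makes the remainder at most [eps * |h|]. *)
  exists (Rmin (r / 2) (eps * (r * r * r) / 2)). split.
  { apply Rmin_pos; [lra|]. assert (0 < r * r * r) by (repeat apply Rmult_lt_0_compat; lra).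
    nra. }
  intros h Hh.
  assert (H1 : Cmod h < r / 2) by (eapply Rlt_le_trans; [exact Hh|apply Rmin_l]).
  assert (H2 : Cmod h < eps * (r * r * r) / 2) by (eapply Rlt_le_trans; [exact Hh|apply Rmin_r]).
  assert (H3 : r / 2 < Cmod (z + h)%C).
  { pose proof (Cmod_minus_le z (- h)%C). rewrite Cmod_opp in H.
    replace (z - - h)%C with (z + h)%C in H by ring. fold r in H. lra. }
  assert (Hzh : (z + h)%C <> 0%C) by (apply Cmod_gt_0; lra).
  replace (/ (z + h) - / z - h * - / (z * z))%C with (h * (h * / (z * z * (z + h))))%C
    by (field; auto).
  rewrite !Cmod_mult, Cmod_inv, !Cmod_mult by (repeat apply Cmult_neq_0; auto).
  fold r. rewrite (Rmult_comm eps). apply Rmult_le_compat_l; [apply Cmod_ge_0|].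
  assert (P : 0 < r * r) by nra.
  apply Rmult_le_reg_r with (r * r * Cmod (z + h)%C).
  { apply Rmult_lt_0_compat; lra. }
  rewrite Rmult_assoc, Rinv_l by (apply Rgt_not_eq; apply Rmult_lt_0_compat; lra).
  assert (eps * (r * r) * (r / 2) <= eps * (r * r) * Cmod (z + h)%C).
  { apply Rmult_le_compat_l; [|lra]. apply Rlt_le, Rmult_lt_0_compat; lra. }
  lra.
Qed.

Lemma is_cderive_div (f g : C -> C) (z l m : C) :
  g z <> 0%C -> is_cderive f z l -> is_cderive g z m ->
  is_cderive (fun y => f y / g y)%C z ((l * g z - f z * m) / (g z * g z))%C.
Proof.
  intros Hz H1 H2.
  eapply is_cderive_eq.
  - apply is_cderive_mult; [exact H1|].
    apply is_cderive_comp; [apply is_cderive_inv; exact Hz|exact H2].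
  - simpl. field. auto.
Qed.

Lemma cderive_locally_bounded (f : C -> C) (z l : C) :
  is_cderive f z l -> exists delta, 0 < delta /\
    forall h, Cmod h < delta -> Cmod (f (z + h) - f z)%C <= (Cmod l + 1) * Cmod h.
Proof.
  intros H. rewrite is_cderive_iff in H. specialize (H 1 Rlt_0_1).
  destruct H as (d & Hd & H). exists d; split; [exact Hd|].
  intros h Hh. specialize (H h Hh).
  pose proof (Cmod_triangle (f (z + h) - f z - h * l)%C (h * l)%C) as T.
  rewrite Cmod_mult in T.
  replace (f (z + h) - f z - h * l + h * l)%C with (f (z + h) - f z)%C in T by ring.
  lra.
Qed.

Lemma cderive_continuous (f : C -> C) (z l : C) :
  is_cderive f z l -> forall eps, 0 < eps -> exists delta, 0 < delta /\
    forall y, Cmod (y - z)%C < delta -> Cmod (f y - f z)%C < eps.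
Proof.
  intros H eps Heps. destruct (cderive_locally_bounded _ _ _ H) as (d & Hd & B).
  pose proof (Cmod_ge_0 l) as Hl.
  exists (Rmin d (eps / (Cmod l + 1))). split.
  { apply Rmin_pos; [lra|]. apply Rdiv_lt_0_compat; lra. }
  intros y Hy. specialize (B (y - z)%C).
  replace (z + (y - z))%C with y in B by ring.
  eapply Rle_lt_trans; [apply B; eapply Rlt_le_trans; [exact Hy|apply Rmin_l]|].
  assert (Cmod (y - z) < eps / (Cmod l + 1)).
  { eapply Rlt_le_trans; [exact Hy|apply Rmin_r]. }
  apply Rmult_lt_reg_r with (/ (Cmod l + 1)); [apply Rinv_0_lt_compat; lra|].
  replace ((Cmod l + 1) * Cmod (y - z) * / (Cmod l + 1)) with (Cmod (y - z)) by (field; lra).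
  exact H0.
Qed.

(** * Curves in the complex plane and the mean value inequality *)

(** Stated by components, so that real calculus and [auto_derive] apply to each of them. *)
Definition is_curve_derive (P : R -> C) (t : R) (l : C) : Prop :=
  is_derive (fun s => fst (P s)) t (fst l) /\
  is_derive (fun s => snd (P s)) t (snd l).

Definition curve_continuous (P : R -> C) (t : R) : Prop :=
  continuity_pt (fun s => fst (P s)) t /\ continuity_pt (fun s => snd (P s)) t.

Lemma curve_derive_continuous (P : R -> C) (t : R) (l : C) :
  is_curve_derive P t l -> curve_continuous P t.
Proof.
  intros [H1 H2]; split; apply derivable_continuous_pt;
    eexists; apply is_derive_Reals; eassumption.
Qed.

Lemma fst_le_Cmod (z : C) : Rabs (fst z) <= Cmod z.
Proof. eapply Rle_trans; [apply Rmax_l|apply Rmax_Cmod]. Qed.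

Lemma snd_le_Cmod (z : C) : Rabs (snd z) <= Cmod z.
Proof. eapply Rle_trans; [apply Rmax_r|apply Rmax_Cmod]. Qed.

Lemma Cmod_le_sum (z : C) : Cmod z <= Rabs (fst z) + Rabs (snd z).
Proof.
  unfold Cmod. apply Rsqr_incr_0_var.
  - rewrite Rsqr_sqrt by nra. unfold Rsqr.
    pose proof (Rabs_pos (fst z)). pose proof (Rabs_pos (snd z)).
    rewrite <- (pow2_abs (fst z)), <- (pow2_abs (snd z)). nra.
  - pose proof (Rabs_pos (fst z)). pose proof (Rabs_pos (snd z)). lra.
Qed.

Lemma Cmod_sqr (z : C) : Cmod z * Cmod z = fst z * fst z + snd z * snd z.
Proof. unfold Cmod. rewrite sqrt_sqrt by nra. ring. Qed.

Lemma dot_le_Cmod (u v : C) : fst u * fst v + snd u * snd v <= Cmod u * Cmod v.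
Proof.
  pose proof (fst_le_Cmod (Cconj u * v)%C) as H. rewrite Cmod_mult, Cmod_conj in H.
  simpl in H. apply Rabs_le_between in H. lra.
Qed.

Lemma curve_derive_line (f : C -> C) (a b l : C) (t : R) :
  is_cderive f (a + t * b)%C l ->
  is_curve_derive (fun s => f (a + s * b)%C) t (b * l)%C.
Proof.
  intros H. rewrite is_cderive_iff in H.
  assert (K : forall eps, 0 < eps -> exists d : posreal, forall h : R, h <> 0 -> Rabs h < d ->
    Cmod (f (a + (t + h)%R * b) - f (a + t * b) - h * (b * l))%C / Rabs h < eps).
  { intros eps Heps. pose proof (Cmod_ge_0 b) as Hb.
    (* The summand 1 covers [b = 0], and the factor 2 yields the strict inequality that a real
       derivative asks for. *)
    destruct (H (eps / (2 * (Cmod b + 1)))) as (d & Hd & Q).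
    { apply Rdiv_lt_0_compat; lra. }
    assert (D : 0 < d / (Cmod b + 1)) by (apply Rdiv_lt_0_compat; lra).
    exists (mkposreal _ D). intros h Hh0 Hh. simpl in Hh.
    assert (Ha : 0 < Rabs h) by now apply Rabs_pos_lt.
    specialize (Q (h * b)%C). rewrite Cmod_mult, Cmod_R in Q.
    replace (a + t * b + h * b)%C with (a + (t + h)%R * b)%C in Q
      by (rewrite RtoC_plus; ring).
    replace (h * b * l)%C with (h * (b * l))%C in Q by ring.
    assert (Hd' : Rabs h * (Cmod b + 1) < d).
    { apply Rmult_lt_compat_r with (r := Cmod b + 1) in Hh; [|lra].
      replace (d / (Cmod b + 1) * (Cmod b + 1)) with d in Hh by (field; lra). exact Hh. }
    assert (Q' := Q ltac:(nra)). clear Q.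
    apply Rmult_lt_reg_r with (Rabs h); [exact Ha|].
    unfold Rdiv at 1. rewrite Rmult_assoc, Rinv_l, Rmult_1_r by lra.
    eapply Rle_lt_trans; [exact Q'|].
    assert (E : eps / (2 * (Cmod b + 1)) * (Cmod b + 1) = eps / 2) by (field; lra).
    assert (E0 : 0 < eps / (2 * (Cmod b + 1))) by (apply Rdiv_lt_0_compat; lra).
    nra. }
  split; apply is_derive_Reals; intros eps Heps; destruct (K eps Heps) as (d & Q);
    exists d; intros h Hh0 Hh; eapply Rle_lt_trans; [|apply (Q h Hh0 Hh)| |apply (Q h Hh0 Hh)];
    assert (Ha : 0 < Rabs h) by (now apply Rabs_pos_lt).
  - replace ((fst (f (a + (t + h)%R * b)%C) - fst (f (a + t * b)%C)) / h - fst (b * l)%C)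
      with (fst (f (a + (t + h)%R * b) - f (a + t * b) - h * (b * l))%C / h)
      by (simpl; field; auto).
    unfold Rdiv. rewrite Rabs_mult, Rabs_inv.
    apply Rmult_le_compat_r; [left; now apply Rinv_0_lt_compat|apply fst_le_Cmod].
  - replace ((snd (f (a + (t + h)%R * b)%C) - snd (f (a + t * b)%C)) / h - snd (b * l)%C)
      with (snd (f (a + (t + h)%R * b) - f (a + t * b) - h * (b * l))%C / h)
      by (simpl; field; auto).
    unfold Rdiv. rewrite Rabs_mult, Rabs_inv.
    apply Rmult_le_compat_r; [left; now apply Rinv_0_lt_compat|apply snd_le_Cmod].
Qed.

Lemma nonneg_derive_le (f df : R -> R) (a b : R) :
  a <= b ->
  (forall t, a < t < b -> is_derive f t (df t) /\ 0 <= df t) ->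
  (forall t, a <= t <= b -> continuity_pt f t) -> f a <= f b.
Proof.
  intros Hab H Hc. destruct Hab as [Hab|<-]; [|lra].
  destruct (Req_dec (f a) (f b)) as [|Hne]; [lra|].
  destruct (Rle_lt_dec (f a) (f b)) as [|Hlt]; [assumption|exfalso].
  assert (pr : forall c, a < c < b -> derivable_pt f c).
  { intros c Hcc. eexists. apply is_derive_Reals. apply H, Hcc. }
  destruct (MVT f id a b pr (fun c _ => derivable_pt_id c) Hab Hc
    (fun c _ => derivable_continuous_pt _ _ (derivable_pt_id c))) as (c & Hcc & E).
  rewrite derive_pt_id in E. unfold id in E.
  destruct (H c Hcc) as [D P].
  rewrite (derive_pt_eq_0 f c (df c) (pr c Hcc)) in E by now apply is_derive_Reals.
  nra.
Qed.

(** The vector [D / |D|] is a norming functional: it replaces a modulus by a real-linear quantity,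
    to which monotonicity arguments in one variable apply. *)
Lemma exists_dot_eq_Cmod (D : C) :
  exists u : C, Cmod u <= 1 /\ fst u * fst D + snd u * snd D = Cmod D.
Proof.
  destruct (Ceq_dec D 0%C) as [E|E].
  - exists 0%C. rewrite Cmod_0, E, Cmod_0. simpl. lra.
  - pose proof (Cmod_neq_0 D E) as HD. exists (D * RtoC (/ Cmod D))%C. split.
    + rewrite Cmod_mult, Cmod_R, Rabs_right by (left; now apply Rinv_0_lt_compat).
      right. field. lra.
    + pose proof (Cmod_sqr D) as S. unfold RtoC, Cmult; cbn [fst snd].
      transitivity ((fst D * fst D + snd D * snd D) * / Cmod D); [ring|].
      rewrite <- S. field. lra.
Qed.

(** Complex curves satisfy no mean value equality. Projecting on the direction [u] of the total
    increment leaves the real function [g - <u, P>], which is nondecreasing because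
    [<u, P'> <= |P'| <= g']. *)
Lemma mean_value_inequality (P P' : R -> C) (g g' : R -> R) (a b : R) :
  a <= b ->
  (forall t, a < t < b ->
     is_curve_derive P t (P' t) /\ is_derive g t (g' t) /\ Cmod (P' t) <= g' t) ->
  (forall t, a <= t <= b -> curve_continuous P t /\ continuity_pt g t) ->
  Cmod (P b - P a)%C <= g b - g a.
Proof.
  intros Hab H Hc.
  destruct (exists_dot_eq_Cmod (P b - P a)%C) as (u & Hu & Eu).
  set (phi := fun t => g t - (fst u * fst (P t) + snd u * snd (P t))).
  assert (L : phi a <= phi b).
  { apply nonneg_derive_le with
      (df := fun t => g' t - (fst u * fst (P' t) + snd u * snd (P' t))); [exact Hab| |].
    - intros t Ht. destruct (H t Ht) as ((D1 & D2) & Dg & B). split.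
      + unfold phi. apply (is_derive_minus g); [exact Dg|].
        apply (is_derive_plus (fun t => fst u * fst (P t))); apply is_derive_scal; assumption.
      + pose proof (dot_le_Cmod u (P' t)). pose proof (Cmod_ge_0 (P' t)). nra.
    - intros t Ht. destruct (Hc t Ht) as ((C1 & C2) & Cg). unfold phi.
      apply (continuity_pt_minus g); [exact Cg|].
      apply (continuity_pt_plus (fun t => fst u * fst (P t)));
        apply (continuity_pt_scal _ (fst u)) || apply (continuity_pt_scal _ (snd u));
        assumption. }
  unfold phi in L. simpl in Eu. lra.
Qed.

(** * Goursat's theorem for rectangles *)

Lemma continuous_curve (P : R -> C) (t : R) :
  (forall eps, 0 < eps -> exists delta, 0 < delta /\
     forall s, Rabs (s - t) < delta -> Cmod (P s - P t)%C < eps) ->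
  continuous (U := C_R_NormedModule) P t.
Proof.
  intros H Q [[eps Heps] HQ]. simpl in HQ.
  destruct (H eps Heps) as (d & Hd & B).
  exists (mkposreal d Hd). intros s Hs. apply HQ.
  change (Rabs (s - t) < d) in Hs. specialize (B s Hs).
  split.
  - change (Rabs (fst (P s - P t)%C) < eps).
    eapply Rle_lt_trans; [apply fst_le_Cmod|exact B].
  - change (Rabs (snd (P s - P t)%C) < eps).
    eapply Rle_lt_trans; [apply snd_le_Cmod|exact B].
Qed.

Definition CInt (P : R -> C) (a b : R) : C :=
  RInt (V := C_R_CompleteNormedModule) P a b.

Lemma CInt_correct (P : R -> C) (a b : R) :
  a <= b -> (forall t, a <= t <= b -> continuous (U := C_R_NormedModule) P t) ->
  is_RInt (V := C_R_NormedModule) P a b (CInt P a b).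
Proof.
  intros Hab H. apply (RInt_correct (V := C_R_CompleteNormedModule)).
  apply (ex_RInt_continuous (V := C_R_CompleteNormedModule)).
  intros t. rewrite Rmin_left, Rmax_right by assumption. apply H.
Qed.

Lemma CInt_Chasles (P : R -> C) (a b c : R) :
  a <= b <= c -> (forall t, a <= t <= c -> continuous (U := C_R_NormedModule) P t) ->
  CInt P a c = (CInt P a b + CInt P b c)%C.
Proof.
  intros Hab H. symmetry.
  apply (RInt_Chasles (V := C_R_CompleteNormedModule));
  apply (ex_RInt_continuous (V := C_R_CompleteNormedModule));
  intros t; rewrite Rmin_left, Rmax_right by lra; intros Ht; apply H; lra.
Qed.

Lemma is_RInt_C_bound (P : R -> C) (a b M : R) (l : C) :
  a <= b -> (forall t, a <= t <= b -> Cmod (P t) <= M) ->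
  is_RInt (V := C_R_NormedModule) P a b l -> Cmod l <= (b - a) * M.
Proof.
  intros Hab H Hl. rewrite Cmod_norm.
  apply (norm_RInt_le_const (V := C_R_NormedModule) P a b l M Hab); [|exact Hl].
  intros t Ht. specialize (H t Ht). now rewrite Cmod_norm in H.
Qed.

(** The fundamental theorem, applied to each component, evaluates the integral of [A], so only
    [P - A] has to be estimated. [A] will be an affine approximation or a constant. *)
Lemma CInt_sub_primitive_bound (P A B : R -> C) (a b M : R) :
  a <= b ->
  (forall t, a <= t <= b -> continuous (U := C_R_NormedModule) P t) ->
  (forall t, is_curve_derive B t (A t)) ->
  (forall t, curve_continuous A t) ->
  (forall t, a <= t <= b -> Cmod (P t - A t)%C <= M) ->
  Cmod (CInt P a b - (B b - B a))%C <= (b - a) * M.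
Proof.
  intros Hab HP HB HA HM.
  apply (is_RInt_C_bound (fun t => P t - A t)%C a b M); [exact Hab|exact HM|].
  apply (is_RInt_minus (V := C_R_NormedModule) P A); [now apply CInt_correct|].
  apply (is_RInt_fct_extend_pair (U := R_NormedModule) (V := R_NormedModule)).
  - apply (is_RInt_derive (fun t => fst (B t))).
    + intros t _. apply HB.
    + intros t _. apply continuity_pt_filterlim. apply HA.
  - apply (is_RInt_derive (fun t => snd (B t))).
    + intros t _. apply HB.
    + intros t _. apply continuity_pt_filterlim. apply HA.
Qed.

(* The integral of [f] along the boundary, counterclockwise, of the rectangle
   with lower left corner [(x, y)], width [w] and height [h]. *)
Definition boundary_integral (f : C -> C) (x y w h : R) : C :=
  Cplus
    (Cminus (CInt (fun s => f (s, y)) x (x + w)) (CInt (fun s => f (s, y + h)) x (x + w)))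
    (Cmult Ci
      (Cminus (CInt (fun s => f (x + w, s)) y (y + h)) (CInt (fun s => f (x, s)) y (y + h)))).

Definition holomorphic_on_rectangle (f : C -> C) (x y w h : R) : Prop :=
  forall s t, x <= s <= x + w -> y <= t <= y + h -> exists l, is_cderive f (s, t) l.

Lemma continuous_horizontal (f : C -> C) (s t : R) (l : C) :
  is_cderive f (s, t) l -> continuous (U := C_R_NormedModule) (fun u => f (u, t)) s.
Proof.
  intros H. apply continuous_curve. intros eps Heps.
  destruct (cderive_continuous _ _ _ H eps Heps) as (d & Hd & B).
  exists d; split; [exact Hd|]. intros u Hu. apply B.
  eapply Rle_lt_trans; [right|exact Hu]. rewrite <- Cmod_R. f_equal.
  unfold RtoC, Cminus, Cplus, Copp; simpl; f_equal; ring.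
Qed.

Lemma continuous_vertical (f : C -> C) (s t : R) (l : C) :
  is_cderive f (s, t) l -> continuous (U := C_R_NormedModule) (fun u => f (s, u)) t.
Proof.
  intros H. apply continuous_curve. intros eps Heps.
  destruct (cderive_continuous _ _ _ H eps Heps) as (d & Hd & B).
  exists d; split; [exact Hd|]. intros u Hu. apply B.
  eapply Rle_lt_trans; [right|exact Hu].
  rewrite <- Cmod_R, <- (Rmult_1_l (Cmod (u - t)%R)), <- Cmod_Ci, <- Cmod_mult. f_equal.
  unfold Ci, RtoC, Cmult, Cminus, Cplus, Copp; simpl; f_equal; ring.
Qed.

(** Each inner side occurs twice with opposite orientations and cancels; the outer halves join by
    Chasles. *)
Lemma boundary_integral_quarter (f : C -> C) (x y w h : R) :
  0 <= w -> 0 <= h -> holomorphic_on_rectangle f x y w h ->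
  boundary_integral f x y w h =
  Cplus (Cplus (Cplus (boundary_integral f x y (w / 2) (h / 2))
      (boundary_integral f (x + w / 2) y (w / 2) (h / 2)))
      (boundary_integral f x (y + h / 2) (w / 2) (h / 2)))
      (boundary_integral f (x + w / 2) (y + h / 2) (w / 2) (h / 2)).
Proof.
  intros Hw Hh Hf.
  assert (HH : forall v, y <= v <= y + h ->
    CInt (fun s => f (s, v)) x (x + w) =
    Cplus (CInt (fun s => f (s, v)) x (x + w / 2)) (CInt (fun s => f (s, v)) (x + w / 2) (x + w))).
  { intros v Hv. apply CInt_Chasles; [lra|]. intros t Ht.
    destruct (Hf t v Ht Hv) as [l Hl]. now apply continuous_horizontal with l. }
  assert (HV : forall u, x <= u <= x + w ->
    CInt (fun s => f (u, s)) y (y + h) =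
    Cplus (CInt (fun s => f (u, s)) y (y + h / 2)) (CInt (fun s => f (u, s)) (y + h / 2) (y + h))).
  { intros u Hu. apply CInt_Chasles; [lra|]. intros t Ht.
    destruct (Hf u t Hu Ht) as [l Hl]. now apply continuous_vertical with l. }
  unfold boundary_integral.
  rewrite (HH y), (HH (y + h)), (HV x), (HV (x + w)) by lra.
  replace (x + w / 2 + w / 2) with (x + w) by lra.
  replace (y + h / 2 + h / 2) with (y + h) by lra.
  ring.
Qed.

(** The affine part [A] of [f] at [z] has the primitive [F] and contributes nothing around a closed
    contour. What remains is at most [eps * (w + h)] on a contour of length [2 * (w + h)]. *)
Lemma boundary_integral_local (f : C -> C) (z l : C) (eps : R) :
  is_cderive f z l -> 0 < eps -> exists delta, 0 < delta /\
    forall x y w h, 0 <= w -> 0 <= h -> w + h < delta ->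
      x <= fst z <= x + w -> y <= snd z <= y + h ->
      holomorphic_on_rectangle f x y w h ->
      Cmod (boundary_integral f x y w h) <= 2 * eps * (w + h) ^ 2.
Proof.
  intros Hl Heps. rewrite is_cderive_iff in Hl.
  destruct (Hl eps Heps) as (d & Hd & B). exists d; split; [exact Hd|].
  intros x y w h Hw Hh Hwh Hx Hy Hf.
  set (A := fun u : C => (f z + (u - z) * l)%C).
  set (F := fun u : C => (f z * u + (u - z) * (u - z) * l / 2)%C).
  assert (E : forall s t, x <= s <= x + w -> y <= t <= y + h ->
    Cmod (f (s, t) - A (s, t))%C <= eps * (w + h)).
  { intros s t Hs Ht.
    assert (Hm : Cmod ((s, t) - z)%C <= w + h).
    { eapply Rle_trans; [apply Cmod_le_sum|]. simpl.
      apply Rplus_le_compat; apply Rabs_le; lra. }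
    specialize (B ((s, t) - z)%C ltac:(lra)).
    rewrite Cplus_minus_cancel in B.
    replace (f (s, t) - A (s, t))%C with (f (s, t) - f z - ((s, t) - z) * l)%C
      by (unfold A; ring).
    eapply Rle_trans; [exact B|]. apply Rmult_le_compat_l; lra. }
  assert (EH : forall t, y <= t <= y + h ->
    Cmod (Cminus (CInt (fun s => f (s, t)) x (x + w)) (F ((x + w)%R, t) - F (x, t))) <= w * (eps * (w + h))).
  { intros t Ht. replace w with (x + w - x) at 3 by lra.
    apply CInt_sub_primitive_bound with (B := fun s => F (s, t)) (A := fun s => A (s, t)).
    - lra.
    - intros s Hs. destruct (Hf s t Hs Ht) as [m Hm]. now apply continuous_horizontal with m.
    - intros s. split; unfold F, A; simpl; auto_derive; trivial; field.
    - intros s. split; unfold A; simpl; apply derivable_continuous_pt;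
        apply ex_derive_Reals_0; auto_derive; trivial.
    - intros s Hs. apply E; assumption. }
  (* Moving upwards multiplies the derivative of [F] by [Ci], so the primitive of [A] along a
     vertical side is [- Ci * F]. *)
  assert (EV : forall s, x <= s <= x + w ->
    Cmod (Cminus (CInt (fun t => f (s, t)) y (y + h)) (- Ci * F (s, (y + h)%R) - - Ci * F (s, y)))
      <= h * (eps * (w + h))).
  { intros s Hs. replace h with (y + h - y) at 3 by lra.
    apply CInt_sub_primitive_bound with (B := fun t => (- Ci * F (s, t))%C) (A := fun t => A (s, t)).
    - lra.
    - intros t Ht. destruct (Hf s t Hs Ht) as [m Hm]. now apply continuous_vertical with m.
    - intros t. split; unfold F, A; simpl; auto_derive; trivial; field.
    - intros t. split; unfold A; simpl; apply derivable_continuous_pt;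
        apply ex_derive_Reals_0; auto_derive; trivial.
    - intros t Ht. apply E; assumption. }
  pose proof (EH y ltac:(lra)) as E1. pose proof (EH (y + h) ltac:(lra)) as E2.
  pose proof (EV x ltac:(lra)) as E3. pose proof (EV (x + w) ltac:(lra)) as E4.
  unfold boundary_integral.
  match type of E1 with Cmod ?a <= _ => set (D1 := a) in * end.
  match type of E2 with Cmod ?a <= _ => set (D2 := a) in * end.
  match type of E3 with Cmod ?a <= _ => set (D3 := a) in * end.
  match type of E4 with Cmod ?a <= _ => set (D4 := a) in * end.
  match goal with |- Cmod ?a <= _ => replace a with (D1 - D2 + Ci * (D4 - D3))%C end.
  (* The corner values of [F] cancel once [Ci * Ci] is replaced by [-1]. *)
  2:{ assert (Hi : (Ci * Ci = -1)%C)
        by (unfold Ci, Cmult, RtoC; simpl; f_equal; ring).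
      unfold D1, D2, D3, D4.
      match goal with |- (_ - (?a - ?b) - (_ - (?c - ?d)) + Ci * (?u - (- Ci * _ - - Ci * _) - (?v - (_ - _))))%C = (?p - ?q + _)%C =>
        transitivity (p - q - (a - b) + (c - d) + Ci * (u - v) + Ci * Ci * (c - a) - Ci * Ci * (d - b))%C end; [ring|].
      rewrite Hi. ring. }
  pose proof (Cmod_triangle (D1 - D2)%C (Ci * (D4 - D3))%C) as T1.
  rewrite Cmod_mult, Cmod_Ci in T1.
  pose proof (Cmod_triangle D1 (- D2)%C) as T2.
  pose proof (Cmod_triangle D4 (- D3)%C) as T3.
  rewrite Cmod_opp in T2, T3. unfold Cminus at 1 3 in T1.
  fold (D1 - D2)%C in *. unfold Cminus in *. lra.
Qed.

Lemma exists_large_quarter (f : C -> C) (w h : R) (q : R * R) :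
  0 <= w -> 0 <= h -> holomorphic_on_rectangle f (fst q) (snd q) w h ->
  exists q' : R * R,
    (fst q <= fst q' <= fst q + w / 2) /\ (snd q <= snd q' <= snd q + h / 2) /\
    Cmod (boundary_integral f (fst q) (snd q) w h)
      <= 4 * Cmod (boundary_integral f (fst q') (snd q') (w / 2) (h / 2)).
Proof.
  intros Hw Hh Hf. destruct q as [x y]; simpl in *.
  rewrite (boundary_integral_quarter f x y w h Hw Hh Hf).
  set (A := boundary_integral f x y (w / 2) (h / 2)).
  set (B := boundary_integral f (x + w / 2) y (w / 2) (h / 2)).
  set (D := boundary_integral f x (y + h / 2) (w / 2) (h / 2)).
  set (E := boundary_integral f (x + w / 2) (y + h / 2) (w / 2) (h / 2)).
  assert (T : Cmod (A + B + D + E)%C <= Cmod A + Cmod B + Cmod D + Cmod E).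
  { eapply Rle_trans; [apply Cmod_triangle|]. apply Rplus_le_compat_r.
    eapply Rle_trans; [apply Cmod_triangle|]. apply Rplus_le_compat_r.
    apply Cmod_triangle. }
  set (S := Cmod (A + B + D + E)%C) in *.
  destruct (Rle_dec S (4 * Cmod A)); [exists (x, y); simpl; repeat split; try lra; assumption|].
  destruct (Rle_dec S (4 * Cmod B)); [exists (x + w / 2, y); simpl; repeat split; try lra; assumption|].
  destruct (Rle_dec S (4 * Cmod D)); [exists (x, y + h / 2); simpl; repeat split; try lra; assumption|].
  exists (x + w / 2, y + h / 2); simpl; repeat split; try lra. fold E. lra.
Qed.

Lemma Rle_of_le_plus_eps_mult (a b c : R) :
  (forall eps, 0 < eps -> a <= b + eps * c) -> a <= b.
Proof.
  intros H. destruct (Rle_lt_dec a b) as [|Hlt]; [assumption|exfalso].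
  pose proof (Rabs_pos c) as Hc.
  assert (Q : 0 < (a - b) / (2 * (Rabs c + 1))) by (apply Rdiv_lt_0_compat; lra).
  specialize (H _ Q).
  assert ((a - b) / (2 * (Rabs c + 1)) * (Rabs c + 1) = (a - b) / 2) by (field; lra).
  pose proof (Rle_abs c). nra.
Qed.

Lemma half_pow_lim (c eps : R) : 0 < eps -> exists n : nat, c / 2 ^ n < eps.
Proof.
  intros Heps. pose proof (Rabs_pos c) as Hc.
  destruct (pow_lt_1_zero (/ 2) ltac:(rewrite Rabs_right; lra) (eps / (Rabs c + 1))
    ltac:(apply Rdiv_lt_0_compat; lra)) as [n Hn].
  exists n. specialize (Hn n (le_n n)). rewrite pow_inv in Hn.
  assert (P : 0 < / 2 ^ n) by (apply Rinv_0_lt_compat, pow_lt; lra).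
  rewrite Rabs_right in Hn by lra.
  apply Rmult_lt_compat_r with (r := Rabs c + 1) in Hn; [|lra].
  replace (eps / (Rabs c + 1) * (Rabs c + 1)) with eps in Hn by (field; lra).
  unfold Rdiv. pose proof (Rle_abs c). nra.
Qed.

(** The common point is the supremum of the left endpoints: every right endpoint is an upper bound
    for them. *)
Lemma nested_dyadic_intervals (a : nat -> R) (w : R) :
  0 <= w -> (forall n, a n <= a (S n) <= a n + w / 2 ^ S n) ->
  exists x, forall n, a n <= x <= a n + w / 2 ^ n.
Proof.
  intros Hw H.
  assert (P : forall n, w / 2 ^ n = w / 2 ^ S n + w / 2 ^ S n).
  { intros n. simpl. field. apply pow_nonzero. lra. }
  assert (M : forall n m, a n <= a (n + m)%nat <= a n + w / 2 ^ n - w / 2 ^ (n + m)).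
  { intros n m. induction m as [|m IH].
    - rewrite Nat.add_0_r. lra.
    - rewrite Nat.add_succ_r. specialize (H (n + m)%nat). specialize (P (n + m)%nat).
      lra. }
  assert (W : forall n, 0 <= w / 2 ^ n).
  { intros n. apply Rmult_le_pos; [exact Hw|]. left. apply Rinv_0_lt_compat, pow_lt. lra. }
  destruct (completeness (fun r => exists n, r = a n)) as [x [Hu Hl]].
  - exists (a 0%nat + w). intros r [n ->]. specialize (M 0%nat n).
    pose proof (W n). simpl in M. lra.
  - exists (a 0%nat), 0%nat. reflexivity.
  - exists x. intros n. split; [apply Hu; now exists n|].
    apply Hl. intros r [m ->].
    destruct (Nat.le_ge_cases n m) as [L|L].
    + replace m with (n + (m - n))%nat by lia. pose proof (M n (m - n)%nat).
      pose proof (W (n + (m - n))%nat). lra.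
    + replace n with (m + (n - m))%nat by lia. pose proof (M m (n - m)%nat).
      pose proof (W (m + (n - m))%nat). lra.
Qed.

(** Bisection: after [n] quarterings the integral has lost at most a factor [4 ^ n], while the local
    estimate at the limit point decays like the squared side length, that is like [eps / 4 ^ n]. The
    two powers cancel and leave a multiple of [eps]. *)
Theorem goursat_rectangle (f : C -> C) (x y w h : R) :
  0 <= w -> 0 <= h -> holomorphic_on_rectangle f x y w h ->
  boundary_integral f x y w h = 0%C.
Proof.
  intros Hw Hh Hf.
  set (good := fun (n : nat) (q : R * R) =>
    (x <= fst q /\ fst q + w / 2 ^ n <= x + w) /\ (y <= snd q /\ snd q + h / 2 ^ n <= y + h)).
  assert (Hgood : forall n q, good n q ->
    holomorphic_on_rectangle f (fst q) (snd q) (w / 2 ^ n) (h / 2 ^ n)).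
  { intros n q [Gx Gy] s t Hs Ht. apply Hf; lra. }
  assert (Pw : forall c n, c / 2 ^ S n = c / 2 ^ n / 2).
  { intros c n. simpl. field. apply pow_nonzero. lra. }
  assert (W : forall c n, 0 <= c -> 0 <= c / 2 ^ n).
  { intros c n Hc. apply Rmult_le_pos; [exact Hc|]. left. apply Rinv_0_lt_compat, pow_lt. lra. }
  set (J := fun (n : nat) (q : R * R) =>
    Cmod (boundary_integral f (fst q) (snd q) (w / 2 ^ n) (h / 2 ^ n))).
  (* The premise [good n q] makes the relation total, as the choice of a step function demands; off
     the good corners [q] itself serves as a dummy successor. *)
  set (next := fun (n : nat) (q q' : R * R) =>
    good n q -> good (S n) q' /\
    (fst q <= fst q' <= fst q + w / 2 ^ S n) /\ (snd q <= snd q' <= snd q + h / 2 ^ S n) /\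
    J n q <= 4 * J (S n) q').
  assert (N : forall n q, exists q', next n q q').
  { intros n q. destruct (classic (good n q)) as [G|G]; [|exists q; intros F; contradiction].
    destruct (exists_large_quarter f (w / 2 ^ n) (h / 2 ^ n) q (W w n Hw) (W h n Hh)
      (Hgood n q G)) as (q' & B1 & B2 & B3).
    exists q'. intros _. unfold good, J. rewrite !Pw. destruct G as [Gx Gy].
    repeat split; try lra. }
  destruct (functional_choice (fun nq q' => next (fst nq) (snd nq) q') (fun nq => N (fst nq) (snd nq)))
    as [step Hstep].
  set (s := nat_rect (fun _ => (R * R)%type) (x, y) (fun n q => step (n, q))).
  assert (Hs : forall n, next n (s n) (s (S n))) by (intros n; exact (Hstep (n, s n))).
  assert (Gs : forall n, good n (s n)).
  { induction n as [|n IH]; [|exact (proj1 (Hs n IH))]. unfold good, s; simpl. repeat split; lra. }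
  assert (Js : forall n, Cmod (boundary_integral f x y w h) <= 4 ^ n * J n (s n)).
  { induction n as [|n IH].
    - unfold J; simpl. rewrite !Rdiv_1_r. lra.
    - destruct (Hs n (Gs n)) as (_ & _ & _ & Q).
      assert (P4 : 0 < 4 ^ n) by (apply pow_lt; lra).
      eapply Rle_trans; [exact IH|].
      change (4 ^ S n) with (4 * 4 ^ n). rewrite (Rmult_comm 4), Rmult_assoc.
      apply Rmult_le_compat_l; [left; exact P4|exact Q]. }
  destruct (nested_dyadic_intervals (fun n => fst (s n)) w Hw) as [X HX].
  { intros n. apply (Hs n (Gs n)). }
  destruct (nested_dyadic_intervals (fun n => snd (s n)) h Hh) as [Y HY].
  { intros n. apply (Hs n (Gs n)). }
  assert (HXY : exists l, is_cderive f (X, Y) l).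
  { specialize (HX 0%nat). specialize (HY 0%nat). simpl in HX, HY. apply Hf; lra. }
  destruct HXY as [l Hl].
  apply Cmod_eq_0. apply Rle_antisym; [|apply Cmod_ge_0].
  apply Rle_of_le_plus_eps_mult with (c := 2 * (w + h) ^ 2). intros eps Heps.
  destruct (boundary_integral_local f (X, Y) l eps Hl Heps) as (d & Hd & B).
  destruct (half_pow_lim (w + h) d Hd) as [n Hn].
  eapply Rle_trans; [apply (Js n)|].
  assert (E : w / 2 ^ n + h / 2 ^ n = (w + h) / 2 ^ n) by (field; apply pow_nonzero; lra).
  specialize (B (fst (s n)) (snd (s n)) (w / 2 ^ n) (h / 2 ^ n) (W w n Hw) (W h n Hh)
    ltac:(lra) (HX n) (HY n) (Hgood n _ (Gs n))).
  assert (P4 : 0 < 4 ^ n) by (apply pow_lt; lra).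
  eapply Rle_trans; [apply Rmult_le_compat_l; [lra|exact B]|].
  rewrite E. right. replace (4 ^ n) with (2 ^ n * 2 ^ n)
    by (rewrite <- Rpow_mult_distr; f_equal; ring).
  field. apply pow_nonzero. lra.
Qed.

(** * The Schwarz lemma *)

Lemma curve_derive_affine_defect (f D : C -> C) (z h : C) (t : R) (c : C) :
  is_curve_derive (fun s => f (z + s * h)%C) t (h * D (z + t * h)%C)%C ->
  is_curve_derive (fun s => f (z + s * h) - s * (h * c))%C t (h * (D (z + t * h) - c))%C.
Proof.
  intros [H1 H2]. split.
  - replace (fst (h * (D (z + t * h) - c))%C)
      with (fst (h * D (z + t * h))%C - fst (h * c)%C) by (simpl; ring).
    apply (is_derive_minus (fun s : R => fst (f (z + s * h)%C))); [exact H1|].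
    simpl. auto_derive; trivial. ring.
  - replace (snd (h * (D (z + t * h) - c))%C)
      with (snd (h * D (z + t * h))%C - snd (h * c)%C) by (simpl; ring).
    apply (is_derive_minus (fun s : R => snd (f (z + s * h)%C))); [exact H2|].
    simpl. auto_derive; trivial. ring.
Qed.

(** The mean value inequality for [f (z + s h) - s h c] on [[0, 1]]. With [c = D z] it proves
    differentiability, with [c = 0] a Lipschitz bound. *)
Lemma directional_increment_bound (f D : C -> C) (z h c : C) (M : R) :
  (forall t, 0 <= t <= 1 ->
     is_curve_derive (fun s => f (z + s * h)%C) t (h * D (z + t * h)%C)%C) ->
  (forall t, 0 <= t <= 1 -> Cmod (D (z + t * h) - c)%C <= M) ->
  Cmod (f (z + h) - f z - h * c)%C <= M * Cmod h.
Proof.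
  intros H B.
  assert (HP : forall t, 0 <= t <= 1 -> is_curve_derive (fun s => f (z + s * h) - s * (h * c))%C t
    (h * (D (z + t * h) - c))%C).
  { intros t Ht. apply curve_derive_affine_defect. now apply H. }
  pose proof (mean_value_inequality (fun s => f (z + s * h) - s * (h * c))%C
    (fun t => h * (D (z + t * h) - c))%C (fun t => t * (M * Cmod h)) (fun _ => M * Cmod h)
    0 1 Rle_0_1) as Q.
  cbv beta in Q.
  replace (f (z + 1%R * h) - 1%R * (h * c) - (f (z + 0%R * h) - 0%R * (h * c)))%C
    with (f (z + h) - f z - h * c)%C in Q.
  - replace (M * Cmod h) with (1 * (M * Cmod h) - 0 * (M * Cmod h)) by ring.
    apply Q.
    + intros t Ht. split; [apply HP; lra|]. split; [auto_derive; trivial; ring|].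
      rewrite Cmod_mult, Rmult_comm. apply Rmult_le_compat_r; [apply Cmod_ge_0|].
      apply B. lra.
    + intros t Ht. split; [eapply curve_derive_continuous; apply HP; lra|].
      apply derivable_continuous_pt, ex_derive_Reals_0. auto_derive. trivial.
  - replace (z + 1%R * h)%C with (z + h)%C by ring.
    replace (z + 0%R * h)%C with z by ring. ring.
Qed.

(** This takes the place of the Cauchy-Riemann equations for functions given by real formulas:
    derivatives along segments are computed by [auto_derive], and continuity of the candidate [D] at
    [z] makes the approximation uniform in the direction. *)
Lemma is_cderive_of_directional (f D : C -> C) (z : C) (r : R) :
  0 < r ->
  (forall h t, Cmod h < r -> 0 <= t <= 1 ->
     is_curve_derive (fun s => f (z + s * h)%C) t (h * D (z + t * h)%C)%C) ->
  (forall eps, 0 < eps -> exists delta, 0 < delta /\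
     forall y, Cmod (y - z)%C < delta -> Cmod (D y - D z)%C < eps) ->
  is_cderive f z (D z).
Proof.
  intros Hr H HD. apply is_cderive_iff. intros eps Heps.
  destruct (HD eps Heps) as (d & Hd & B).
  exists (Rmin r d). split; [now apply Rmin_pos|]. intros h Hh.
  apply directional_increment_bound with D.
  - intros t Ht. apply H; [eapply Rlt_le_trans; [exact Hh|apply Rmin_l]|exact Ht].
  - intros t Ht. left. apply B.
    replace (z + t * h - z)%C with (t * h)%C by ring.
    rewrite Cmod_mult, Cmod_R, Rabs_right by lra.
    pose proof (Rmin_r r d). pose proof (Cmod_ge_0 h). nra.
Qed.

(** * The complex exponential *)

Definition cexp (z : C) : C := (exp (fst z) * cos (snd z), exp (fst z) * sin (snd z)).

Lemma Cmod_cexp (z : C) : Cmod (cexp z) = exp (fst z).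
Proof.
  pose proof (Cmod_sqr (cexp z)) as S. simpl in S.
  pose proof (sin2_cos2 (snd z)) as T. unfold Rsqr in T.
  pose proof (exp_pos (fst z)). pose proof (Cmod_ge_0 (cexp z)). nra.
Qed.

Lemma cexp_plus (a b : C) : cexp (a + b)%C = (cexp a * cexp b)%C.
Proof.
  unfold cexp, Cmult; simpl. rewrite exp_plus, cos_plus, sin_plus. f_equal; ring.
Qed.

Lemma cexp_0 : cexp 0%C = 1%C.
Proof. unfold cexp, RtoC; simpl. rewrite exp_0, cos_0, sin_0. f_equal; ring. Qed.

Lemma cexp_neq_0 (z : C) : cexp z <> 0%C.
Proof. apply Cmod_gt_0. rewrite Cmod_cexp. apply exp_pos. Qed.

Lemma cexp_opp (z : C) : cexp (- z)%C = (/ cexp z)%C.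
Proof.
  pose proof (cexp_neq_0 z) as Hz.
  assert (E : (cexp (- z) * cexp z)%C = 1%C).
  { rewrite <- cexp_plus, <- cexp_0. f_equal. ring. }
  replace (cexp (- z)%C) with (cexp (- z) * cexp z * / cexp z)%C by (field; exact Hz).
  rewrite E. ring.
Qed.

Lemma cexp_RtoC (x : R) : cexp (RtoC x) = RtoC (exp x).
Proof. unfold cexp, RtoC; simpl. rewrite cos_0, sin_0. f_equal; ring. Qed.

Lemma cexp_directional (z h : C) (t : R) :
  is_curve_derive (fun s => cexp (z + s * h)%C) t (h * cexp (z + t * h)%C)%C.
Proof.
  split; unfold cexp; simpl; unfold Rminus; auto_derive; trivial; ring.
Qed.

Lemma is_cderive_cexp (z : C) : is_cderive cexp z (cexp z).
Proof.
  apply is_cderive_of_directional with (r := 1); [lra|intros; apply cexp_directional|].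
  (* On the disk of radius 1 about [z] the exponential has modulus at most [M]; hence it is
     [M]-Lipschitz there from [z], which gives the continuity of its derivative. *)
  intros eps Heps. set (M := exp (fst z + 1)).
  assert (HM : 0 < M) by apply exp_pos.
  exists (Rmin 1 (eps / M)). split; [apply Rmin_pos; [lra|now apply Rdiv_lt_0_compat]|].
  intros y Hy.
  assert (H1 : Cmod (y - z)%C < 1) by (eapply Rlt_le_trans; [exact Hy|apply Rmin_l]).
  assert (H2 : Cmod (y - z)%C < eps / M) by (eapply Rlt_le_trans; [exact Hy|apply Rmin_r]).
  pose proof (directional_increment_bound cexp cexp z (y - z)%C 0%C M) as Q.
  rewrite Cplus_minus_cancel in Q.
  replace (cexp y - cexp z - (y - z) * 0)%C with (cexp y - cexp z)%C in Q by ring.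
  eapply Rle_lt_trans; [apply Q|].
  - intros; apply cexp_directional.
  - intros t Ht. replace (cexp (z + t * (y - z)) - 0)%C with (cexp (z + t * (y - z))%C) by ring.
    rewrite Cmod_cexp.
    unfold M. pose proof (fst_le_Cmod (y - z)%C) as F. apply Rabs_le_between in F.
    assert (E : fst (z + t * (y - z))%C <= fst z + 1) by (simpl in *; nra).
    destruct E as [E|E]; [left; now apply exp_increasing|right; now rewrite E].
  - apply Rmult_lt_compat_l with (r := M) in H2; [|exact HM].
    replace (M * (eps / M)) with eps in H2 by (field; lra). exact H2.
Qed.

Lemma CInt_const_dist (P : R -> C) (a b M : R) (c : C) :
  a <= b -> (forall t, a <= t <= b -> continuous (U := C_R_NormedModule) P t) ->
  (forall t, a <= t <= b -> Cmod (P t - c)%C <= M) ->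
  Cmod (CInt P a b - RtoC (b - a) * c)%C <= (b - a) * M.
Proof.
  intros Hab HP HM.
  pose proof (CInt_sub_primitive_bound P (fun _ => c) (fun t => RtoC t * c)%C a b M Hab HP) as Q.
  replace (RtoC (b - a) * c)%C with (b * c - a * c)%C by (rewrite RtoC_minus; ring).
  apply Q; [| |exact HM].
  - intros t. split; simpl; auto_derive; trivial; ring.
  - intros t. split; simpl; apply continuity_pt_const; intros ? ?; reflexivity.
Qed.

(* Goursat's theorem for [v (exp s) / exp s] on [ln s <= Re <= ln r]: the
   horizontal sides cancel by periodicity, so that [v z / z] has the same mean
   over the circles of radii [s] and [r]; let [s] tend to [0] and [r] to [1]. *)
Lemma schwarz_derivative_at_0 (v : C -> C) (l : C) :
  (forall z, Cmod z < 1 -> exists m, is_cderive v z m) ->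
  (forall z, Cmod z < 1 -> Cmod (v z) <= 1) ->
  v 0%C = 0%C -> is_cderive v 0%C l -> Cmod l <= 1.
Proof.
  intros Hv Bv V0 Hl.
  assert (K : forall r eps, 0 < r < 1 -> 0 < eps -> Cmod l <= / r + eps).
  { intros r eps Hr Heps. rewrite is_cderive_iff in Hl.
    destruct (Hl eps Heps) as (d & Hd & B).
    set (s := Rmin (r / 2) (d / 2)).
    assert (Hs : 0 < s) by (apply Rmin_pos; lra).
    assert (Hsr : s < r) by (unfold s; pose proof (Rmin_l (r / 2) (d / 2)); lra).
    assert (Hsd : s < d) by (unfold s; pose proof (Rmin_r (r / 2) (d / 2)); lra).
    set (f := fun z => (v (cexp z) * cexp (- z))%C).
    assert (Hln : ln s < ln r) by (apply ln_increasing; lra).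
    assert (Hlr : ln r < 0) by (rewrite <- ln_1; apply ln_increasing; lra).
    assert (HP : 0 < 2 * PI) by (pose proof PI_RGT_0; lra).
    assert (Hf : forall z, fst z <= ln r -> exists m, is_cderive f z m).
    { intros z Hz. destruct (Hv (cexp z)) as [m Hm].
      { rewrite Cmod_cexp, <- exp_0. apply exp_increasing. lra. }
      eexists. apply is_cderive_mult.
      - apply is_cderive_comp; [exact Hm|apply is_cderive_cexp].
      - apply (is_cderive_comp cexp (fun y => - y)%C); [apply is_cderive_cexp|].
        apply (is_cderive_ext_loc (fun y => 0 - y)%C _ _ _ 1); [lra|intros; ring|].
        apply is_cderive_minus; [apply is_cderive_const|apply is_cderive_id]. }
    assert (G : boundary_integral f (ln s) 0 (ln r - ln s) (2 * PI) = 0%C).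
    { apply goursat_rectangle; [lra|lra|]. intros a b Ha Hb. apply Hf. simpl. lra. }
    unfold boundary_integral in G.
    replace (ln s + (ln r - ln s)) with (ln r) in G by ring.
    rewrite Rplus_0_l in G.
    assert (EP : forall a, f (a, 2 * PI) = f (a, 0)).
    { intros a. unfold f. rewrite !cexp_opp. unfold cexp; simpl.
      rewrite sin_2PI, cos_2PI, sin_0, cos_0. reflexivity. }
    assert (EI : CInt (fun a => f (a, 2 * PI)) (ln s) (ln r) = CInt (fun a => f (a, 0)) (ln s) (ln r)).
    { apply (RInt_ext (V := C_R_CompleteNormedModule)). intros a _. apply EP. }
    rewrite EI in G.
    assert (EV : CInt (fun y => f (ln r, y)) 0 (2 * PI) = CInt (fun y => f (ln s, y)) 0 (2 * PI)).
    { set (a := CInt (fun y => f (ln r, y)) 0 (2 * PI)) in *.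
      set (b := CInt (fun y => f (ln s, y)) 0 (2 * PI)) in *.
      set (c := CInt (fun y => f (y, 0)) (ln s) (ln r)) in *.
      assert (E : (Ci * (a - b) = 0)%C) by (rewrite <- G; ring).
      assert (E' : (a - b = 0)%C).
      { apply Cmod_eq_0. rewrite <- (Rmult_1_l (Cmod _)), <- Cmod_Ci, <- Cmod_mult, E.
        apply Cmod_0. }
      replace a with (a - b + b)%C by ring. rewrite E'. ring. }
    assert (HC : forall x, x <= ln r -> forall y,
      continuous (U := C_R_NormedModule) (fun y => f (x, y)) y).
    { intros x Hx y. destruct (Hf (x, y) Hx) as [m Hm]. now apply continuous_vertical with m. }
    pose proof (CInt_const_dist (fun y => f (ln r, y)) 0 (2 * PI) (/ r) 0%C ltac:(lra)
      (fun t _ => HC (ln r) (Rle_refl _) t)) as B1.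
    pose proof (CInt_const_dist (fun y => f (ln s, y)) 0 (2 * PI) eps l ltac:(lra)
      (fun t _ => HC (ln s) (Rlt_le _ _ Hln) t)) as B2.
    rewrite EV in B1. set (I := CInt (fun y => f (ln s, y)) 0 (2 * PI)) in *.
    (* On the outer circle [|v| <= 1] bounds the integrand by [1 / r]; on the inner one
       differentiability at [0] keeps it within [eps] of [l]. Both describe the same integral
       [I]. *)
    assert (N1 : Cmod (I - RtoC (2 * PI - 0) * 0)%C <= (2 * PI - 0) * / r).
    { apply B1. intros t _. replace (f (ln r, t) - 0)%C with (f (ln r, t)) by ring.
      unfold f. rewrite Cmod_mult, Cmod_cexp. simpl. rewrite exp_Ropp, exp_ln by lra.
      rewrite <- (Rmult_1_l (/ r)) at 2. apply Rmult_le_compat_r.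
      - left. apply Rinv_0_lt_compat. lra.
      - apply Bv. rewrite Cmod_cexp. simpl. rewrite exp_ln; lra. }
    assert (N2 : Cmod (I - RtoC (2 * PI - 0) * l)%C <= (2 * PI - 0) * eps).
    { apply B2. intros t _. set (h := cexp (ln s, t)).
      assert (Hh : Cmod h = s) by (unfold h; rewrite Cmod_cexp; simpl; apply exp_ln; lra).
      specialize (B h ltac:(lra)). rewrite V0, Hh in B.
      assert (h0 : h <> 0%C) by apply cexp_neq_0.
      unfold f. rewrite cexp_opp. fold h.
      replace (v h * / h - l)%C with ((v (0 + h) - 0 - h * l) / h)%C
        by (replace (0 + h)%C with h by ring; field; exact h0).
      rewrite Cmod_div, Hh by exact h0. apply Rmult_le_reg_r with s; [lra|].
      unfold Rdiv. rewrite Rmult_assoc, Rinv_l by lra. lra. }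
    replace (I - RtoC (2 * PI - 0) * 0)%C with I in N1 by ring.
    pose proof (Cmod_minus_le (RtoC (2 * PI - 0) * l) I)%C as M.
    rewrite (Cmod_minus_sym _ I), Cmod_mult, Cmod_R, Rabs_right in M by lra.
    apply Rmult_le_reg_l with (2 * PI); lra. }
  destruct (Rle_lt_dec (Cmod l) 1) as [|Hlt]; [assumption|exfalso].
  (* With this radius [1 / r] is the midpoint of 1 and [|l|], and this [eps] is half of the gap left
     above it, so the bound falls strictly below [|l|]. *)
  specialize (K (2 / (1 + Cmod l)) ((Cmod l - 1) / 4)).
  assert (K1 : 0 < 2 / (1 + Cmod l)) by (apply Rdiv_lt_0_compat; lra).
  assert (K2 : 2 / (1 + Cmod l) < 1).
  { apply Rmult_lt_reg_r with (1 + Cmod l); [lra|]. unfold Rdiv.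
    rewrite Rmult_assoc, Rinv_l; lra. }
  assert (K3 : / (2 / (1 + Cmod l)) = (1 + Cmod l) / 2) by (field; lra).
  rewrite K3 in K. specialize (K (conj K1 K2)). lra.
Qed.

(** * Moebius maps and the Schwarz-Pick inequality *)

Lemma Cconj_mult_self (a : C) : (Cconj a * a)%C = RtoC (Cmod a * Cmod a).
Proof. rewrite Cmod_sqr. unfold Cconj, Cmult, RtoC; simpl. f_equal; ring. Qed.

Lemma moebius_denominator_neq_0 (a z : C) :
  Cmod a < 1 -> Cmod z < 1 -> (1 + Cconj a * z)%C <> 0%C.
Proof.
  intros Ha Hz E. pose proof (Cmod_minus_le 1%C (- (Cconj a * z))%C) as H.
  replace (1 - - (Cconj a * z))%C with (1 + Cconj a * z)%C in H by ring.
  rewrite E, Cmod_0, Cmod_opp, Cmod_mult, Cmod_conj, Cmod_1 in H.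
  pose proof (Cmod_ge_0 a). pose proof (Cmod_ge_0 z). nra.
Qed.

(** The reason is the identity [|1 + conj a z|^2 - |z + a|^2 = (1 - |a|^2) (1 - |z|^2)]. *)
Lemma moebius_lt_1 (a z : C) :
  Cmod a < 1 -> Cmod z < 1 -> Cmod ((z + a) / (1 + Cconj a * z))%C < 1.
Proof.
  intros Ha Hz. pose proof (moebius_denominator_neq_0 a z Ha Hz) as D.
  rewrite Cmod_div by exact D. apply Cmod_gt_0 in D.
  apply Rmult_lt_reg_r with (Cmod (1 + Cconj a * z)%C); [exact D|].
  unfold Rdiv. rewrite Rmult_assoc, Rinv_l, Rmult_1_l, Rmult_1_r by lra.
  pose proof (Cmod_sqr (z + a)%C) as S1. pose proof (Cmod_sqr (1 + Cconj a * z)%C) as S2.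
  pose proof (Cmod_sqr a) as S3. pose proof (Cmod_sqr z) as S4.
  pose proof (Cmod_ge_0 a). pose proof (Cmod_ge_0 z). pose proof (Cmod_ge_0 (z + a)%C).
  assert (P : 0 < (1 - Cmod a * Cmod a) * (1 - Cmod z * Cmod z)) by (apply Rmult_lt_0_compat; nra).
  simpl in S1, S2. rewrite S3, S4 in P.
  assert (Cmod (z + a)%C * Cmod (z + a)%C < Cmod (1 + Cconj a * z)%C * Cmod (1 + Cconj a * z)%C)
    by (rewrite S1, S2; nra).
  nra.
Qed.

Lemma is_cderive_moebius (a z : C) :
  Cmod a < 1 -> Cmod z < 1 ->
  is_cderive (fun y => (y + a) / (1 + Cconj a * y))%C z
    ((1 - Cconj a * a) / ((1 + Cconj a * z) * (1 + Cconj a * z)))%C.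
Proof.
  intros Ha Hz. pose proof (moebius_denominator_neq_0 a z Ha Hz) as D.
  eapply is_cderive_eq.
  - apply is_cderive_div; [exact D| |].
    + apply is_cderive_plus; [apply is_cderive_id|apply is_cderive_const].
    + apply is_cderive_plus; [apply is_cderive_const|].
      apply is_cderive_mult; [apply is_cderive_const|apply is_cderive_id].
  - simpl. field. exact D.
Qed.

(** With [T] sending [0] to [a] and [S] sending [b = w a] to [0], the composite [S o w o T] fixes
    [0]. Since [T' 0 = 1 - |a|^2] and [S' b = 1 / (1 - |b|^2)], the bound on its derivative at [0]
    is the claim. *)
Lemma schwarz_pick_derivative (w : C -> C) (a l : C) :
  (forall z, Cmod z < 1 -> exists m, is_cderive w z m) ->
  (forall z, Cmod z < 1 -> Cmod (w z) < 1) ->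
  Cmod a < 1 -> is_cderive w a l ->
  Cmod l * (1 - Cmod a ^ 2) <= 1 - Cmod (w a) ^ 2.
Proof.
  intros Hw Bw Ha Hl. set (b := w a). assert (Hb : Cmod b < 1) by now apply Bw.
  assert (Hnb : Cmod (- b)%C < 1) by now rewrite Cmod_opp.
  set (T := fun y => ((y + a) / (1 + Cconj a * y))%C).
  set (S := fun y => ((y + - b) / (1 + Cconj (- b) * y))%C).
  assert (T0 : T 0%C = a) by (unfold T; field).
  assert (H0 : Cmod 0%C < 1) by (rewrite Cmod_0; lra).
  pose proof (schwarz_derivative_at_0 (fun y => S (w (T y)))
    (((1 - Cconj a * a) * l) / (1 - Cconj b * b))%C) as Q.
  pose proof (Cmod_ge_0 a) as Pa. pose proof (Cmod_ge_0 b) as Pb.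
  assert (Na : 0 < 1 - Cmod a * Cmod a) by nra.
  assert (Nb : 0 < 1 - Cmod b * Cmod b) by nra.
  assert (Eb : (1 - Cconj b * b)%C = RtoC (1 - Cmod b * Cmod b))
    by (rewrite Cconj_mult_self, RtoC_minus; reflexivity).
  assert (Db : (1 - Cconj b * b)%C <> 0%C).
  { rewrite Eb. intros F. injection F. lra. }
  assert (Q1 : Cmod ((1 - Cconj a * a) * l / (1 - Cconj b * b))%C <= 1).
  { apply Q.
    - intros z Hz. assert (Tz : Cmod (T z) < 1) by now apply moebius_lt_1.
      destruct (Hw (T z) Tz) as [m Hm].
      eexists. apply is_cderive_comp; [apply is_cderive_moebius; [exact Hnb|now apply Bw]|].
      apply is_cderive_comp; [exact Hm|]. now apply is_cderive_moebius.
    - intros z Hz. left. apply moebius_lt_1; [exact Hnb|]. apply Bw. now apply moebius_lt_1.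
    - rewrite T0. fold b. unfold S, Cdiv. ring.
    - eapply is_cderive_eq.
      + apply is_cderive_comp; [apply is_cderive_moebius; [exact Hnb|]|].
        * rewrite T0. exact Hb.
        * apply is_cderive_comp; [rewrite T0; exact Hl|]. now apply is_cderive_moebius.
      + rewrite T0. fold b.
        replace (Cconj (- b)) with (- Cconj b)%C
          by (unfold Cconj, Copp; simpl; f_equal; ring).
        field. replace (1 + - Cconj b * b)%C with (1 - Cconj b * b)%C by ring. auto. }
  rewrite Cmod_div, Cmod_mult in Q1 by exact Db.
  rewrite Eb, Cmod_R, Cconj_mult_self in Q1.
  replace (1 - RtoC (Cmod a * Cmod a))%C with (RtoC (1 - Cmod a * Cmod a)) in Q1
    by now rewrite RtoC_minus.
  rewrite Cmod_R, !Rabs_right in Q1 by lra.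
  apply Rmult_le_compat_r with (r := 1 - Cmod b * Cmod b) in Q1; [|lra].
  unfold Rdiv in Q1. rewrite Rmult_assoc, Rinv_l in Q1 by lra. lra.
Qed.

(** Schwarz-Pick says that [w] does not increase hyperbolic length. Along the segment from [0] to
    [z], the projection [x] of [w] on the direction of [w z] therefore satisfies
    [x' / (1 - x^2) <= r / (1 - (t r)^2)]. Integration compares [ln ((1 + x) / (1 - x))] at the
    endpoint with the same expression in [r], and this function is increasing. *)
Theorem schwarz_lemma (w : C -> C) (z : C) :
  (forall y, Cmod y < 1 -> exists m, is_cderive w y m) ->
  (forall y, Cmod y < 1 -> Cmod (w y) < 1) ->
  w 0%C = 0%C -> Cmod z < 1 -> Cmod (w z) <= Cmod z.
Proof.
  intros Hw Bw W0 Hz.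
  destruct (exists_dot_eq_Cmod (w z)) as (u & Hu & Eu).
  set (r := Cmod z) in *. assert (Hr : 0 <= r) by apply Cmod_ge_0.
  set (x := fun t : R => fst u * fst (w (0 + t * z)%C) + snd u * snd (w (0 + t * z)%C)).
  assert (Ht : forall t, 0 <= t <= 1 -> Cmod (0 + t * z)%C = t * r /\ t * r < 1).
  { intros t Ht. replace (0 + t * z)%C with (t * z)%C by ring.
    rewrite Cmod_mult, Cmod_R, Rabs_right by lra. fold r. split; [reflexivity|nra]. }
  assert (Bx : forall t, 0 <= t <= 1 -> Rabs (x t) <= Cmod (w (0 + t * z)%C) < 1).
  { intros t H. destruct (Ht t H) as [E L]. split; [|apply Bw; lra].
    pose proof (dot_le_Cmod u (w (0 + t * z)%C)) as A1.
    pose proof (dot_le_Cmod u (- w (0 + t * z))%C) as A2.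
    rewrite Cmod_opp in A2. simpl in A2. pose proof (Cmod_ge_0 (w (0 + t * z)%C)).
    unfold x. simpl in A1 |- *. apply Rabs_le. split; nra. }
  assert (Dx : forall t, 0 <= t <= 1 -> exists m : R, is_derive x t m /\
    m * (1 - (t * r) ^ 2) <= r * (1 - x t ^ 2)).
  { intros t H. destruct (Ht t H) as [E L].
    destruct (Hw (0 + t * z)%C ltac:(lra)) as [l Hl].
    pose proof (schwarz_pick_derivative w _ l Hw Bw ltac:(rewrite E; exact L) Hl) as SP.
    rewrite E in SP. destruct (curve_derive_line w 0%C z l t Hl) as [D1 D2].
    exists (fst u * fst (z * l)%C + snd u * snd (z * l)%C). split.
    - apply (is_derive_plus (fun t : R => fst u * fst (w (0 + t * z)%C)));
        apply is_derive_scal; assumption.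
    - pose proof (dot_le_Cmod u (z * l)%C) as A. rewrite Cmod_mult in A. fold r in A.
      destruct (Bx t H) as [B1 B2]. pose proof (Cmod_ge_0 l) as Pl.
      assert (Htr : 0 <= t * r) by (apply Rmult_le_pos; lra).
      assert (Q : 0 <= 1 - (t * r) ^ 2) by (simpl; nra).
      (* Projecting only shrinks the modulus, so replacing [|w|] by [x] weakens the right-hand side
         in the permitted direction. *)
      assert (X2 : x t ^ 2 <= Cmod (w (0 + t * z)%C) ^ 2).
      { rewrite <- (pow2_abs (x t)). apply pow_incr. split; [apply Rabs_pos|exact B1]. }
      assert (A' : fst u * fst (z * l)%C + snd u * snd (z * l)%C <= r * Cmod l)
        by (assert (0 <= r * Cmod l) by nra; nra).
      apply Rle_trans with (r * Cmod l * (1 - (t * r) ^ 2)); [now apply Rmult_le_compat_r|].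
      rewrite Rmult_assoc. apply Rmult_le_compat_l; lra. }
  assert (L : ln (1 + 0 * r) - ln (1 - 0 * r) - (ln (1 + x 0) - ln (1 - x 0)) <=
    ln (1 + 1 * r) - ln (1 - 1 * r) - (ln (1 + x 1) - ln (1 - x 1))).
  (* The derivatives of [x] are gathered into one function [dx], as the monotonicity lemma expects;
     outside [[0, 1]] its values are arbitrary. *)
  { destruct (functional_choice (fun t m : R => 0 <= t <= 1 -> is_derive x t m /\
      m * (1 - (t * r) ^ 2) <= r * (1 - x t ^ 2))) as [dx Hdx].
    { intros t. destruct (classic (0 <= t <= 1)) as [H|H].
      - destruct (Dx t H) as [m Hm]. exists m. intros _. exact Hm.
      - exists 0. intros; contradiction. }
    assert (D : forall t, 0 <= t <= 1 -> is_derive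
      (fun t => ln (1 + t * r) - ln (1 - t * r) - (ln (1 + x t) - ln (1 - x t))) t
      (2 * r / (1 - (t * r) ^ 2) - 2 * dx t / (1 - x t ^ 2))).
    { intros t H. destruct (Ht t H) as [_ B]. destruct (Bx t H) as [B1 B2].
      destruct (Hdx t H) as [Hd _].
      pose proof (Rabs_def2 (x t) 1 (Rle_lt_trans _ _ _ B1 B2)) as B3.
      assert (B4 : 0 <= t * r) by (apply Rmult_le_pos; lra).
      auto_derive.
      - repeat split; try lra; exists (dx t); exact Hd.
      - replace (Derive (fun y : R => x y) t) with (dx t) by (symmetry; exact (is_derive_unique x t _ Hd)). field.
        repeat split; nra. }
    apply (nonneg_derive_le (fun t => ln (1 + t * r) - ln (1 - t * r) - (ln (1 + x t) - ln (1 - x t)))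
      (fun t => 2 * r / (1 - (t * r) ^ 2) - 2 * dx t / (1 - x t ^ 2))); [lra| |].
    - intros t H. split; [apply D; lra|].
      destruct (Ht t ltac:(lra)) as [_ B]. destruct (Bx t ltac:(lra)) as [B1 B2].
      destruct (Hdx t ltac:(lra)) as [_ Hd].
      pose proof (Rabs_def2 (x t) 1 (Rle_lt_trans _ _ _ B1 B2)) as B3.
      assert (B4 : 0 <= t * r) by (apply Rmult_le_pos; lra).
      assert (P1 : 0 < 1 - (t * r) ^ 2) by nra. assert (P2 : 0 < 1 - x t ^ 2) by nra.
      replace (2 * r / (1 - (t * r) ^ 2) - 2 * dx t / (1 - x t ^ 2))
        with (2 * (r * (1 - x t ^ 2) - dx t * (1 - (t * r) ^ 2)) / ((1 - (t * r) ^ 2) * (1 - x t ^ 2)))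
        by (field; lra).
      apply Rmult_le_pos; [lra|]. left. apply Rinv_0_lt_compat. now apply Rmult_lt_0_compat.
    - intros t H. apply derivable_continuous_pt. eexists. apply is_derive_Reals. apply D, H. }
  assert (X1 : x 1 = Cmod (w z)).
  { unfold x. replace (0 + 1%R * z)%C with z by ring. exact Eu. }
  assert (X0 : x 0 = 0).
  { unfold x. replace (0 + 0%R * z)%C with (RtoC 0) by ring. rewrite W0. simpl. ring. }
  rewrite X1, X0 in L.
  replace (1 + 0 * r) with 1 in L by ring. replace (1 - 0 * r) with 1 in L by ring.
  rewrite Rplus_0_r, Rminus_0_r, ln_1, Rmult_1_l in L.
  pose proof (Bw z Hz) as B.
  destruct (Rle_lt_dec (Cmod (w z)) r) as [|Hlt]; [assumption|exfalso].
  pose proof (ln_increasing (1 + r) (1 + Cmod (w z)) ltac:(lra) ltac:(lra)).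
  pose proof (ln_increasing (1 - Cmod (w z)) (1 - r) ltac:(lra) ltac:(lra)).
  lra.
Qed.

(** * Subordination to the nephroid map *)

Lemma Cmod_cube_diff_le (a b : C) (r : R) :
  Cmod a <= r -> Cmod b <= r -> Cmod (a * a + a * b + b * b)%C <= 3 * (r * r).
Proof.
  intros Ha Hb. pose proof (Cmod_ge_0 a). pose proof (Cmod_ge_0 b).
  eapply Rle_trans; [apply Cmod_triangle|].
  eapply Rle_trans; [apply Rplus_le_compat_r, Cmod_triangle|].
  rewrite !Cmod_mult. nra.
Qed.

Lemma RtoC_neq_0 (x : R) : x <> 0 -> RtoC x <> 0%C.
Proof. intros H E. apply H. injection E. auto. Qed.

Lemma contraction_limit (x : nat -> C) (q : R) :
  0 <= q < 1 -> (forall n, Cmod (x (S n) - x n)%C <= q ^ n) ->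
  exists l : C, forall eps, 0 < eps -> exists N : nat, forall n, (N <= n)%nat ->
    Cmod (x n - l)%C < eps.
Proof.
  intros Hq H.
  destruct (ex_series_le (V := C_R_CompleteNormedModule) (fun n => x (S n) - x n)%C
    (fun n => q ^ n)) as [l Hl].
  - intros n. specialize (H n). rewrite Cmod_norm in H. exact H.
  - exists (/ (1 - q)). apply is_series_geom. rewrite Rabs_right; lra.
  - exists (x 0%nat + l)%C. intros eps Heps.
    assert (S1 : forall n, @sum_n C_AbelianGroup (fun n => x (S n) - x n)%C n = (x (S n) - x 0%nat)%C).
    { induction n as [|n IH]; [now rewrite sum_O|]. rewrite sum_Sn, IH.
      change ((x (S n) - x 0%nat + (x (S (S n)) - x (S n)))%C = (x (S (S n)) - x 0%nat)%C). ring. }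
    assert (Q : 0 < eps / 2) by lra.
    destruct (Hl (fun y => Cmod (y - l)%C < eps)) as [N HN].
    { exists (mkposreal _ Q). intros y [H1 H2].
      change (Rabs (fst (y - l)%C) < eps / 2) in H1.
      change (Rabs (snd (y - l)%C) < eps / 2) in H2.
      eapply Rle_lt_trans; [apply Cmod_le_sum|]. lra. }
    (* The partial sum up to [n] telescopes to [x (S n) - x 0], hence the shift by one. *)
    exists (S N). intros [|n] Hn; [lia|]. specialize (HN n ltac:(lia)).
    change (Cmod (@sum_n C_AbelianGroup (fun n => x (S n) - x n)%C n - l)%C < eps) in HN.
    rewrite S1 in HN.
    replace (x (S n) - (x 0%nat + l))%C with (x (S n) - x 0%nat - l)%C by ring. exact HN.
Qed.

(** If [|x| <= 1], then [|u + x^3 / 3| <= |u| + 1/3 = r < 1]. The iteration thus stays in the disk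
    of radius [r], where the factor [(a^2 + a b + b^2) / 3] of a difference of cubes is at most
    [r^2 < 1]. The bound on the root is kept because it selects the right one among three. *)
Lemma cubic_root_exists (u : C) :
  Cmod u < 2 / 3 -> exists o : C, Cmod o <= 1 / 3 + Cmod u /\ (o - o ^ 3 / 3)%C = u.
Proof.
  intros Hu. set (r := 1 / 3 + Cmod u). pose proof (Cmod_ge_0 u) as Pu.
  assert (Hr : 0 < r < 1) by (unfold r; lra).
  set (x := fix x (n : nat) : C := match n with O => 0%C | S n => (u + x n * x n * x n / 3)%C end).
  assert (T3 : Cmod 3%C = 3) by (rewrite Cmod_R, Rabs_right; lra).
  assert (N3 : (3 : C) <> 0%C) by (apply RtoC_neq_0; lra).
  assert (Bx : forall n, Cmod (x n) <= r).
  { induction n as [|n IH]; [simpl; rewrite Cmod_0; lra|].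
    change (x (S n)) with (u + x n * x n * x n / 3)%C.
    eapply Rle_trans; [apply Cmod_triangle|].
    rewrite Cmod_div, !Cmod_mult, T3 by exact N3.
    pose proof (Cmod_ge_0 (x n)) as P.
    assert (Cmod (x n) * Cmod (x n) * Cmod (x n) <= 1).
    { assert (Cmod (x n) * Cmod (x n) <= 1) by nra. nra. }
    unfold r. lra. }
  assert (Dx : forall n, Cmod (x (S n) - x n)%C <= (r * r) ^ n).
  { induction n as [|n IH].
    - change (x 1%nat) with (u + 0 * 0 * 0 / 3)%C. simpl.
      replace (u + 0 * 0 * 0 / 3 - 0)%C with u by field. lra.
    - change (x (S (S n))) with (u + x (S n) * x (S n) * x (S n) / 3)%C.
      change (x (S n)) with (u + x n * x n * x n / 3)%C at 4.
      replace (u + x (S n) * x (S n) * x (S n) / 3 - (u + x n * x n * x n / 3))%C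
        with ((x (S n) * x (S n) + x (S n) * x n + x n * x n) / 3 * (x (S n) - x n))%C
        by field.
      rewrite Cmod_mult. change ((r * r) ^ S n) with (r * r * (r * r) ^ n).
      apply Rmult_le_compat; try apply Cmod_ge_0; [|exact IH].
      rewrite Cmod_div, T3 by exact N3.
      pose proof (Cmod_cube_diff_le _ _ r (Bx (S n)) (Bx n)). lra. }
  assert (Hq : 0 <= r * r < 1).
  { split; [apply Rmult_le_pos; lra|].
    rewrite <- (Rmult_1_r 1). apply Rmult_le_0_lt_compat; lra. }
  destruct (contraction_limit x (r * r) Hq Dx) as [o Ho].
  assert (Bo : Cmod o <= r).
  { apply Rle_of_le_plus_eps_mult with (c := 1). intros eps Heps.
    destruct (Ho eps Heps) as [N HN]. specialize (HN N (le_n N)).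
    pose proof (Cmod_minus_le o (x N)) as M. rewrite Cmod_minus_sym in M.
    specialize (Bx N). lra. }
  exists o. split; [exact Bo|].
  enough (Z : (o - o ^ 3 / 3 - u)%C = 0%C).
  { transitivity (o - o ^ 3 / 3 - u + u)%C; [ring|]. rewrite Z. ring. }
  apply Cmod_eq_0. apply Rle_antisym; [|apply Cmod_ge_0].
  apply Rle_of_le_plus_eps_mult with (c := 2). intros eps Heps.
  destruct (Ho eps Heps) as [N HN].
  pose proof (HN N (le_n N)) as H1. pose proof (HN (S N) ltac:(lia)) as H2.
  replace (o - o ^ 3 / 3 - u)%C with
    (- (x (S N) - o) + (x N * x N + x N * o + o * o) / 3 * (x N - o))%C
    by (change (x (S N)) with (u + x N * x N * x N / 3)%C; field; exact N3).
  eapply Rle_trans; [apply Cmod_triangle|].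
  rewrite Cmod_opp, Cmod_mult, Cmod_div, T3 by exact N3.
  pose proof (Cmod_cube_diff_le _ _ r (Bx N) Bo) as B.
  pose proof (Cmod_ge_0 (x N - o)%C). pose proof (Cmod_ge_0 (x N * x N + x N * o + o * o)%C).
  assert (Cmod (x N * x N + x N * o + o * o)%C / 3 <= 1) by nra.
  nra.
Qed.

(** For roots [o] of [u] and [p] of [u + h], [h] factors as [p - o] times a number of modulus at
    least [1 - r^2]. So any choice of roots within the bound is Lipschitz near [u], and its
    derivative is read off the equation without an inverse function theorem. *)
Lemma cubic_root_holomorphic (om : C -> C) (u : C) :
  (forall v, Cmod v < 2 / 3 ->
     Cmod (om v) <= 1 / 3 + Cmod v /\ (om v - om v ^ 3 / 3)%C = v) ->
  Cmod u < 2 / 3 -> exists l, is_cderive om u l.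
Proof.
  intros H Hu. set (o := om u). pose proof (Cmod_ge_0 u) as Pu.
  (* For [|h| < (2/3 - |u|) / 2] the modulus of [u + h] is at most the mean of [|u|] and 2/3, so [r]
     bounds the roots of both equations. *)
  set (r := 1 / 3 + (Cmod u + 2 / 3) / 2).
  assert (Hr : 0 < r < 1) by (unfold r; lra).
  destruct (H u Hu) as [Bo Eo]. fold o in Bo, Eo.
  assert (Br : Cmod o <= r) by (unfold r; lra). pose proof (Cmod_ge_0 o) as Po.
  assert (Do : (1 - o * o)%C <> 0%C).
  { apply Cmod_gt_0. pose proof (Cmod_minus_le 1%C (o * o)%C) as M.
    rewrite Cmod_1, Cmod_mult in M. nra. }
  assert (T3 : Cmod 3%C = 3) by (rewrite Cmod_R, Rabs_right; lra).
  assert (N3 : (3 : C) <> 0%C) by (apply RtoC_neq_0; lra).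
  exists (/ (1 - o * o))%C. apply is_cderive_iff. intros eps Heps.
  set (L := Cmod (/ (1 - o * o))%C). assert (PL : 0 <= L) by apply Cmod_ge_0.
  set (k := 1 - r * r). assert (Hk : 0 < k) by (unfold k; nra).
  (* The remainder is at most [|p - o|^2 * L] with [|p - o| <= |h| / k]; this [d] makes it at most
     [eps * |h|]. *)
  set (d := eps * (k * k) / (L + 1)).
  assert (Hd : 0 < d) by (apply Rdiv_lt_0_compat; [apply Rmult_lt_0_compat; nra|lra]).
  exists (Rmin ((2 / 3 - Cmod u) / 2) d). split; [apply Rmin_pos; lra|].
  intros h Hh.
  assert (H1 : Cmod h < (2 / 3 - Cmod u) / 2) by (eapply Rlt_le_trans; [exact Hh|apply Rmin_l]).
  assert (H2 : Cmod h < d) by (eapply Rlt_le_trans; [exact Hh|apply Rmin_r]).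
  pose proof (Cmod_triangle u h) as T.
  destruct (H (u + h)%C ltac:(lra)) as [B E]. set (p := om (u + h)%C) in *. fold o.
  assert (Bp : Cmod p <= r) by (unfold r; lra). pose proof (Cmod_ge_0 p) as Pp.
  assert (Eh : h = ((p - o) * (1 - (p * p + p * o + o * o) / 3))%C).
  { transitivity ((u + h) - u)%C; [ring|]. rewrite <- E, <- Eo. field. }
  assert (Lip : k * Cmod (p - o)%C <= Cmod h).
  { rewrite Eh, Cmod_mult, Rmult_comm. apply Rmult_le_compat_l; [apply Cmod_ge_0|].
    pose proof (Cmod_minus_le 1%C ((p * p + p * o + o * o) / 3)%C) as M.
    rewrite Cmod_1, Cmod_div, T3 in M by exact N3.
    pose proof (Cmod_cube_diff_le p o r Bp Br). unfold k. lra. }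
  (* The error is quadratic in [p - o], because [1 - o^2 - (1 - (p^2 + p o + o^2) / 3) = (o - p) (2
     o + p) / 3] up to sign. *)
  replace (p - o - h * / (1 - o * o))%C
    with ((p - o) * (p - o) * / (1 - o * o) * ((2 * o + p) / 3))%C.
  2:{ rewrite Eh. field. exact Do. }
  rewrite !Cmod_mult. fold L.
  assert (B3 : Cmod ((2 * o + p) / 3)%C <= 1).
  { rewrite Cmod_div, T3 by exact N3. pose proof (Cmod_triangle (2 * o) p)%C as M.
    rewrite Cmod_mult, Cmod_R, Rabs_right in M by lra. lra. }
  pose proof (Cmod_ge_0 (p - o)%C) as PD. set (D := Cmod (p - o)%C) in *.
  pose proof (Cmod_ge_0 h) as Ph. set (m := Cmod h) in *.
  assert (Q1 : D * D * L * Cmod ((2 * o + p) / 3)%C <= D * D * (L + 1)).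
  { pose proof (Cmod_ge_0 ((2 * o + p) / 3)%C).
    apply Rle_trans with (D * D * L); [|nra].
    rewrite <- (Rmult_1_r (D * D * L)) at 2. apply Rmult_le_compat_l; [|exact B3].
    apply Rmult_le_pos; nra. }
  eapply Rle_trans; [exact Q1|].
  apply Rmult_le_reg_l with (k * k); [nra|].
  apply Rle_trans with (m * m * (L + 1)).
  { replace (k * k * (D * D * (L + 1))) with ((k * D) * (k * D) * (L + 1)) by ring.
    apply Rmult_le_compat_r; [lra|]. assert (0 <= k * D) by nra. nra. }
  assert (m * (L + 1) <= eps * (k * k)).
  { replace (eps * (k * k)) with (d * (L + 1)) by (unfold d; field; lra). nra. }
  nra.
Qed.

Lemma analytic_phiNe : analytic_disk phiNe.
Proof.
  intros z _.
  assert (N3 : (3 : C) <> 0%C) by (apply RtoC_neq_0; lra).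
  assert (H : exists l, is_cderive (fun y => 1 + y - y * y * y / 3)%C z l).
  { eexists. apply is_cderive_minus.
    - apply is_cderive_plus; [apply is_cderive_const|apply is_cderive_id].
    - apply is_cderive_div; [exact N3| |apply is_cderive_const].
      apply is_cderive_mult; [|apply is_cderive_id].
      apply is_cderive_mult; apply is_cderive_id. }
  destruct H as [l Hl]. exists l.
  apply (is_cderive_ext_loc _ phiNe z l 1) in Hl; [exact Hl|lra|].
  intros y _. unfold phiNe. field.
Qed.

Lemma subordinate_phiNe (p : C -> C) :
  analytic_disk p -> p (RtoC 0) = RtoC 1 ->
  (forall z, Cmod z < 1 -> Cmod (p z - 1)%C < 2 / 3) ->
  subordinate p phiNe.
Proof.
  intros Hp P0 B. split; [exact Hp|]. split; [exact analytic_phiNe|].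
  destruct (functional_choice (fun v o => Cmod v < 2 / 3 ->
    Cmod o <= 1 / 3 + Cmod v /\ (o - o ^ 3 / 3)%C = v)) as [om Hom].
  { intros v. destruct (Rlt_dec (Cmod v) (2 / 3)) as [H|H].
    - destruct (cubic_root_exists v H) as [o Ho]. exists o. intros _. exact Ho.
    - exists 0%C. intros; contradiction. }
  exists (fun z => om (p z - 1)%C). repeat split.
  - intros z Hz. destruct (cubic_root_holomorphic om (p z - 1)%C Hom (B z Hz)) as [l Hl].
    destruct (Hp z Hz) as [m Hm].
    eexists. apply (is_cderive_comp om (fun y => p y - 1)%C); [exact Hl|].
    apply is_cderive_minus; [exact Hm|apply is_cderive_const].
  - rewrite P0. replace (1 - 1)%C with (RtoC 0) by ring.
    destruct (Hom (RtoC 0)) as [B0 E0]; [rewrite Cmod_0; lra|].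
    set (o := om (RtoC 0)) in *. rewrite Cmod_0 in B0.
    (* The equation alone would also allow the roots of [o^2 = 3]; the bound [|o| <= 1/3] leaves
       only [0]. *)
    assert (E : o = (o ^ 3 / 3)%C).
    { transitivity (o - o ^ 3 / 3 + o ^ 3 / 3)%C; [ring|]. rewrite E0. ring. }
    apply Cmod_eq_0. apply (f_equal Cmod) in E.
    rewrite Cmod_div, Cmod_pow, Cmod_R, Rabs_right in E by (try apply RtoC_neq_0; lra).
    pose proof (Cmod_ge_0 o). simpl in E. nra.
  - intros z Hz. destruct (Hom _ (B z Hz)) as [Bz _]. specialize (B z Hz). lra.
  - intros z Hz. destruct (Hom _ (B z Hz)) as [_ Ez]. unfold phiNe.
    transitivity (1 + (om (p z - 1) - om (p z - 1) ^ 3 / 3))%C; [|ring].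
    rewrite Ez. ring.
Qed.

(** * Estimates along rays *)

Lemma curve_derive_ray (f : C -> C) (z l : C) (t : R) :
  is_cderive f (t * z)%C l -> is_curve_derive (fun s => f (s * z)%C) t (z * l)%C.
Proof.
  intros H. replace (t * z)%C with (0 + t * z)%C in H by ring.
  destruct (curve_derive_line f 0%C z l t H) as [H1 H2].
  split; [eapply is_derive_ext; [|exact H1]|eapply is_derive_ext; [|exact H2]];
    intros s; simpl; do 2 f_equal; ring.
Qed.

Lemma Cmod_ray (t : R) (z : C) : 0 <= t -> Cmod (t * z)%C = t * Cmod z.
Proof. intros H. rewrite Cmod_mult, Cmod_R, Rabs_right; lra. Qed.

Lemma ray_increment (f f' : C -> C) (z : C) (g g' : R -> R) (s : R) :
  0 <= s ->
  (forall t, 0 <= t <= s -> is_cderive f (t * z)%C (f' (t * z)%C)) ->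
  (forall t, 0 <= t <= s -> is_derive g t (g' t)) ->
  (forall t, 0 < t < s -> Cmod z * Cmod (f' (t * z)%C) <= g' t) ->
  Cmod (f (s * z) - f 0)%C <= g s - g 0.
Proof.
  intros Hs Hf Hg B. replace (f 0%C) with (f (0%R * z)%C) by (f_equal; ring).
  apply (mean_value_inequality (fun t => f (t * z)%C) (fun t => z * f' (t * z))%C g g'); [exact Hs| |].
  - intros t Ht. split; [apply curve_derive_ray, Hf; lra|]. split; [apply Hg; lra|].
    rewrite Cmod_mult. now apply B.
  - intros t Ht. split.
    + eapply curve_derive_continuous, curve_derive_ray, Hf, Ht.
    + apply derivable_continuous_pt. eexists. apply is_derive_Reals, Hg, Ht.
Qed.

(** A Gronwall argument: [exp (- 2 g) |f|^2] is nonincreasing. The square of the modulus is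
    differentiable even where [f] vanishes; [psi] is the negative, so that monotonicity applies in
    its nondecreasing form. *)
Lemma ray_growth (f f' : C -> C) (z : C) (g g' : R -> R) (s : R) :
  0 <= s ->
  (forall t, 0 <= t <= s -> is_cderive f (t * z)%C (f' (t * z)%C)) ->
  (forall t, 0 <= t <= s -> is_derive g t (g' t)) ->
  f 0%C = 1%C ->
  (forall t, 0 < t < s -> Cmod z * Cmod (f' (t * z)%C) <= g' t * Cmod (f (t * z)%C)) ->
  Cmod (f (s * z)%C) <= exp (g s - g 0).
Proof.
  intros Hs Hf Hg F0 B.
  set (psi := fun t => exp (- 2 * g t) *
    - (fst (f (t * z)%C) * fst (f (t * z)%C) + snd (f (t * z)%C) * snd (f (t * z)%C))).
  set (dpsi := fun t =>
    exp (- 2 * g t) * (2 * (g' t * (Cmod (f (t * z)%C) * Cmod (f (t * z)%C))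
      - (fst (f (t * z)%C) * fst (z * f' (t * z)%C)%C
         + snd (f (t * z)%C) * snd (z * f' (t * z)%C)%C)))).
  assert (D : forall t, 0 <= t <= s -> is_derive psi t (dpsi t)).
  { intros t Ht. destruct (curve_derive_ray f z _ t (Hf t Ht)) as [D1 D2].
    specialize (Hg t Ht).
    set (p1 := fun t : R => fst (f (t * z)%C)).
    set (p2 := fun t : R => snd (f (t * z)%C)).
    change (is_derive p1 t (fst (z * f' (t * z))%C)) in D1.
    change (is_derive p2 t (snd (z * f' (t * z))%C)) in D2.
    apply (is_derive_ext (fun t => exp (- 2 * g t) * - (p1 t * p1 t + p2 t * p2 t)));
      [intros; reflexivity|].
    unfold dpsi. rewrite Cmod_sqr. fold (p1 t) (p2 t).
    change (fst (f (t * z)%C)) with (p1 t). change (snd (f (t * z)%C)) with (p2 t).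
    clearbody p1 p2. auto_derive.
    - repeat split; trivial; eexists; eassumption.
    - replace (Derive (fun y : R => p1 y) t) with (fst (z * f' (t * z)%C)%C)
        by (symmetry; exact (is_derive_unique p1 t _ D1)).
      replace (Derive (fun y : R => p2 y) t) with (snd (z * f' (t * z)%C)%C)
        by (symmetry; exact (is_derive_unique p2 t _ D2)).
      replace (Derive (fun y : R => g y) t) with (g' t)
        by (symmetry; exact (is_derive_unique g t _ Hg)).
      ring. }
  assert (L : psi 0 <= psi s).
  { apply nonneg_derive_le with dpsi; [exact Hs| |].
    - intros t Ht. split; [apply D; lra|]. unfold dpsi.
      apply Rmult_le_pos; [left; apply exp_pos|].
      pose proof (dot_le_Cmod (f (t * z)%C) (z * f' (t * z))%C) as Q.
      rewrite Cmod_mult in Q. pose proof (Cmod_ge_0 (f (t * z)%C)). specialize (B t Ht).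
      nra.
    - intros t Ht. apply derivable_continuous_pt. eexists. apply is_derive_Reals, D, Ht. }
  unfold psi in L. rewrite <- !Cmod_sqr in L.
  replace (0%R * z)%C with (RtoC 0) in L by ring. rewrite F0, Cmod_1 in L.
  set (m := Cmod (f (s * z)%C)) in *. assert (Pm : 0 <= m) by apply Cmod_ge_0.
  apply Rsqr_incr_0_var; [|left; apply exp_pos]. unfold Rsqr.
  rewrite <- exp_plus.
  replace (g s - g 0 + (g s - g 0)) with (2 * g s + - 2 * g 0) by ring.
  rewrite exp_plus.
  apply Rmult_le_reg_l with (exp (- 2 * g s)); [apply exp_pos|].
  rewrite <- (Rmult_assoc _ (exp (2 * g s))), <- (exp_plus (- 2 * g s)).
  replace (- 2 * g s + 2 * g s) with 0 by ring. rewrite exp_0. lra.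
Qed.

(** A lower bound on everything before a first zero contradicts continuity there. It is tailored to
    (b) and (c), whose estimates are available only as long as [p] has not vanished. *)
Lemma nonvanishing_on_ray (f : C -> C) (z : C) :
  (forall t, 0 <= t <= 1 -> exists l, is_cderive f (t * z)%C l) ->
  f 0%C <> 0%C ->
  (forall t, 0 < t <= 1 -> (forall s, 0 <= s < t -> f (s * z)%C <> 0%C) ->
     exists c, 0 < c /\ forall s, 0 <= s < t -> c <= Cmod (f (s * z)%C)) ->
  forall t, 0 <= t <= 1 -> f (t * z)%C <> 0%C.
Proof.
  intros Hf F0 H t1 Ht1 E1.
  assert (Cont : forall t, 0 <= t <= 1 -> forall eps, 0 < eps -> exists d, 0 < d /\
    forall s, Rabs (s - t) < d -> Cmod (f (s * z) - f (t * z))%C < eps).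
  { intros t Ht eps Heps. destruct (Hf t Ht) as [l Hl].
    destruct (cderive_continuous f _ l Hl eps Heps) as (d & Hd & B).
    pose proof (Cmod_ge_0 z) as Pz.
    exists (d / (Cmod z + 1)). split; [apply Rdiv_lt_0_compat; lra|].
    intros s Hs. apply B. replace (s * z - t * z)%C with (RtoC (s - t) * z)%C
      by (rewrite RtoC_minus; ring).
    rewrite Cmod_mult, Cmod_R.
    apply Rmult_lt_compat_r with (r := Cmod z + 1) in Hs; [|lra].
    replace (d / (Cmod z + 1) * (Cmod z + 1)) with d in Hs by (field; lra).
    pose proof (Rabs_pos (s - t)). lra. }
  (* The negatives of the zeros are collected, so that the supremum [x] gives the smallest zero
     [t0 = - x]. *)
  destruct (completeness (fun s => 0 <= - s <= 1 /\ f ((- s)%R * z)%C = 0%C)) as [x [Hu Hl]].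
  { exists 0. intros s [Hs _]. lra. }
  { exists (- t1). rewrite Ropp_involutive. auto. }
  set (t0 := - x).
  assert (B0 : 0 <= t0 <= t1).
  { unfold t0. split.
    - assert (x <= 0); [|lra]. apply Hl. intros s [Hs _]. lra.
    - assert (- t1 <= x); [|lra]. apply Hu. rewrite Ropp_involutive. auto. }
  assert (Z : f (t0 * z)%C = 0%C).
  { destruct (Ceq_dec (f (t0 * z)%C) 0%C) as [|N]; [assumption|exfalso].
    destruct (Cont t0 ltac:(lra) _ (Cmod_neq_0 _ N)) as (d & Hd & B).
    assert (x <= x - d); [|lra]. apply Hl. intros s [Hs Es].
    destruct (Rle_lt_dec s (x - d)) as [|L]; [assumption|exfalso].
    specialize (Hu s (conj Hs Es)). specialize (B (- s)).
    rewrite Es in B. replace (0 - f (t0 * z))%C with (- f (t0 * z))%C in B by ring.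
    rewrite Cmod_opp in B. assert (Rabs (- s - t0) < d); [|specialize (B H0); lra].
    unfold t0. apply Rabs_def1; lra. }
  assert (P0 : 0 < t0).
  { destruct B0 as [[L|E0] _]; [exact L|exfalso]. apply F0. rewrite <- E0 in Z.
    replace (0%R * z)%C with (RtoC 0) in Z by ring. exact Z. }
  destruct (H t0 ltac:(lra)) as (c & Hc & Bc).
  { intros s Hs Es. assert (- s <= x); [|unfold t0 in Hs; lra].
    apply Hu. rewrite Ropp_involutive. split; [lra|exact Es]. }
  destruct (Cont t0 ltac:(lra) c Hc) as (d & Hd & B).
  set (m := Rmin t0 d). assert (Hm : 0 < m) by now apply Rmin_pos.
  pose proof (Rmin_l t0 d) as M1. pose proof (Rmin_r t0 d) as M2. fold m in M1, M2.
  specialize (B (t0 - m / 2)). rewrite Z in B.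
  replace (f ((t0 - m / 2)%R * z) - 0)%C with (f ((t0 - m / 2)%R * z))%C in B by ring.
  assert (Q : Rabs (t0 - m / 2 - t0) < d) by (apply Rabs_def1; lra).
  specialize (B Q). specialize (Bc (t0 - m / 2) ltac:(lra)). lra.
Qed.

(** * The majorant of [phi0] and the constants of the theorem *)

Lemma k0_gt_2 : 2 < k0.
Proof.
  unfold k0. pose proof (sqrt_lt_1 1 2 ltac:(lra) ltac:(lra) ltac:(lra)) as H.
  rewrite sqrt_1 in H. lra.
Qed.

(* [phi0 z - 1 = z * majorant' z], where [majorant'] has positive Taylor coefficients;
   hence [|majorant' w| <= majorant' |w|]. *)
Definition majorant (s : R) : R := - (s / k0) - 2 * ln (1 - s / k0).

Definition majorant' (s : R) : R := (k0 + s) / (k0 * (k0 - s)).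

Lemma is_derive_majorant (s : R) : s <= 1 -> is_derive majorant s (majorant' s).
Proof.
  intros Hs. pose proof k0_gt_2 as K. unfold majorant, majorant'.
  assert (P : 0 < 1 - s / k0).
  { apply Rmult_lt_reg_r with k0; [lra|]. unfold Rdiv.
    rewrite Rmult_minus_distr_r, Rmult_assoc, Rinv_l; lra. }
  auto_derive.
  - unfold Rdiv in P. lra.
  - field. lra.
Qed.

Lemma majorant'_pos (s : R) : 0 <= s <= 1 -> 0 < majorant' s.
Proof.
  intros Hs. pose proof k0_gt_2. unfold majorant'.
  apply Rdiv_lt_0_compat; [lra|]. apply Rmult_lt_0_compat; lra.
Qed.

Lemma majorant_0 : majorant 0 = 0.
Proof. unfold majorant. rewrite Rdiv_0_l, Rminus_0_r, ln_1. ring. Qed.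

Lemma majorant_lt (r s : R) : 0 <= r < s -> s <= 1 -> majorant r < majorant s.
Proof.
  intros Hr Hs.
  destruct (MVT_cor2 majorant majorant' r s ltac:(lra)) as (c & E & Hc).
  - intros c Hc. apply is_derive_Reals, is_derive_majorant. lra.
  - pose proof (majorant'_pos c ltac:(lra)). nra.
Qed.

Lemma majorant_1 : majorant 1 = 2 * (ln (1 + 1 / sqrt 2) - (sqrt 2 - 1) / 2).
Proof.
  pose proof (sqrt_lt_1 1 2 ltac:(lra) ltac:(lra) ltac:(lra)) as H. rewrite sqrt_1 in H.
  pose proof (sqrt_sqrt 2 ltac:(lra)) as S. unfold majorant, k0.
  assert (E : 1 / (sqrt 2 + 1) = sqrt 2 - 1).
  { apply Rmult_eq_reg_r with (sqrt 2 + 1); [|lra]. field_simplify; [|lra]. nra. }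
  rewrite E.
  (* Since [1 / k0 = sqrt 2 - 1], the argument of the logarithm is [2 - sqrt 2]; its inverse is the
     argument that occurs in the bounds. *)
  assert (E2 : 1 - (sqrt 2 - 1) = / (1 + 1 / sqrt 2)).
  { apply Rmult_eq_reg_r with (1 + 1 / sqrt 2).
    2:{ assert (0 < 1 / sqrt 2) by (apply Rdiv_lt_0_compat; lra). lra. }
    rewrite Rinv_l.
    2:{ assert (0 < 1 / sqrt 2) by (apply Rdiv_lt_0_compat; lra). lra. }
    apply Rmult_eq_reg_r with (sqrt 2); [|lra].
    replace ((1 - (sqrt 2 - 1)) * (1 + 1 / sqrt 2) * sqrt 2)
      with ((1 - (sqrt 2 - 1)) * (sqrt 2 + 1)) by (field; lra).
    nra. }
  rewrite E2, ln_Rinv; [field|].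
  assert (0 < 1 / sqrt 2) by (apply Rdiv_lt_0_compat; lra). lra.
Qed.

Lemma beta_a_majorant : beta_a = 3 / 2 * majorant 1.
Proof. rewrite majorant_1. unfold beta_a. field. Qed.

Lemma beta_bc_constant :
  ln ((1 + sqrt 2) / sqrt 2) - 1 / (2 * (1 + sqrt 2)) = majorant 1 / 2.
Proof.
  pose proof (sqrt_lt_1 1 2 ltac:(lra) ltac:(lra) ltac:(lra)) as H. rewrite sqrt_1 in H.
  pose proof (sqrt_sqrt 2 ltac:(lra)) as S. rewrite majorant_1.
  replace ((1 + sqrt 2) / sqrt 2) with (1 + 1 / sqrt 2) by (field; lra).
  replace (1 / (2 * (1 + sqrt 2))) with ((sqrt 2 - 1) / 2); [field|].
  apply Rmult_eq_reg_r with (2 * (1 + sqrt 2)); [|lra]. field_simplify; [|lra]. nra.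
Qed.

Lemma beta_b_majorant : beta_b = majorant 1 / ln (5 / 3).
Proof. unfold beta_b. rewrite beta_bc_constant. f_equal. field. Qed.

Lemma beta_c_majorant : beta_c = 5 / 2 * majorant 1.
Proof. unfold beta_c. rewrite beta_bc_constant. field. Qed.

Lemma majorant_1_pos : 0 < majorant 1.
Proof. rewrite <- majorant_0. apply majorant_lt; lra. Qed.

(** The triangle inequality makes the numerator largest and the denominator smallest at the positive
    point [r]. *)
Lemma Cmod_majorant'_le (v : C) (r : R) :
  Cmod v <= r -> r <= 1 -> Cmod ((k0 + v) / (k0 * (k0 - v)))%C <= majorant' r.
Proof.
  intros Hv Hr. pose proof k0_gt_2 as K.
  pose proof (Cmod_ge_0 v) as Pv. pose proof (Cmod_minus_le k0 v) as M.
  pose proof (Cmod_triangle k0 v) as T.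
  rewrite Cmod_R, Rabs_right in M, T by lra.
  assert (Nk : RtoC k0 <> 0%C) by (apply RtoC_neq_0; lra).
  assert (Nv : (k0 - v)%C <> 0%C) by (apply Cmod_gt_0; lra).
  rewrite Cmod_div, Cmod_mult, Cmod_R, (Rabs_right k0)
    by (try (apply Cmult_neq_0; assumption); lra).
  unfold majorant'. apply Rmult_le_compat; [apply Cmod_ge_0| |lra|].
  - left. apply Rinv_0_lt_compat. apply Rmult_lt_0_compat; lra.
  - apply Rinv_le_contravar; [apply Rmult_lt_0_compat; lra|].
    apply Rmult_le_compat_l; lra.
Qed.

Lemma k0_minus_neq_0 (z : C) : Cmod z < 1 -> (k0 - z)%C <> 0%C.
Proof.
  intros Hz. pose proof k0_gt_2 as K. apply Cmod_gt_0.
  pose proof (Cmod_minus_le k0 z) as M. rewrite Cmod_R, Rabs_right in M; lra.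
Qed.

Lemma phi0_eq (z : C) :
  Cmod z < 1 -> phi0 z = (1 + z * ((k0 + z) / (k0 * (k0 - z))))%C.
Proof.
  intros Hz. pose proof k0_gt_2 as K. unfold phi0. field.
  split; [now apply k0_minus_neq_0|apply RtoC_neq_0; lra].
Qed.

Lemma subordinate_phi0_bound (f : C -> C) (z : C) :
  subordinate f phi0 -> Cmod z < 1 -> Cmod (f z - 1)%C <= Cmod z * majorant' (Cmod z).
Proof.
  intros (_ & _ & w & Hw & W0 & Bw & E) Hz.
  pose proof (schwarz_lemma w z Hw Bw W0 Hz) as S.
  rewrite (E z Hz), phi0_eq by now apply Bw. set (v := w z) in *.
  replace (1 + v * ((k0 + v) / (k0 * (k0 - v))) - 1)%C
    with (v * ((k0 + v) / (k0 * (k0 - v))))%C by ring.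
  rewrite Cmod_mult.
  apply Rmult_le_compat; [apply Cmod_ge_0|apply Cmod_ge_0|exact S|].
  apply Cmod_majorant'_le; lra.
Qed.

Lemma is_derive_majorant_ray (beta r t : R) :
  0 < beta -> t * r <= 1 ->
  is_derive (fun t => majorant (t * r) / beta) t (r * majorant' (t * r) / beta).
Proof.
  intros Hb Ht.
  apply is_derive_Reals.
  replace (r * majorant' (t * r) / beta) with (/ beta * (majorant' (t * r) * r)) by (field; lra).
  apply is_derive_Reals.
  apply (is_derive_ext (fun t : R => / beta * majorant (t * r))); [intros; apply Rmult_comm|].
  apply is_derive_scal.
  replace (majorant' (t * r) * r) with (r * majorant' (t * r)) by ring.
  apply (is_derive_comp majorant (fun t : R => t * r)); [now apply is_derive_majorant|].
  auto_derive; trivial. ring.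
Qed.

Lemma analytic_derive (p : C -> C) (z : C) :
  analytic_disk p -> Cmod z < 1 -> is_cderive p z (C_derive p z).
Proof. intros Hp Hz. apply C_derive_correct; [exact z|]. now apply Hp. Qed.

(** * The three implications *)

(** Only [t] is cancelled; [r = |z|] stays on both sides, so [z = 0] is no special case. *)
Lemma ray_slope_bound (beta t r m b : R) :
  0 < beta -> 0 < t -> beta * (t * r * m) <= t * r * b -> r * m <= r * b / beta.
Proof.
  intros Hb Ht H. apply Rmult_le_reg_l with (beta * t); [now apply Rmult_lt_0_compat|].
  replace (beta * t * (r * b / beta)) with (t * r * b) by (field; lra). lra.
Qed.

(** Shared by the three cases: [q] stands for [p'], [p' / p] or [p' / p^2]. *)
Lemma subordinate_lhs_slope (p q : C -> C) (beta : R) (z : C) (t : R) :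
  0 < beta -> Cmod z < 1 -> 0 < t <= 1 ->
  subordinate (fun y => 1 + beta * (y * q y))%C phi0 ->
  Cmod z * Cmod (q (t * z)%C) <= Cmod z * majorant' (t * Cmod z) / beta.
Proof.
  intros Hb Hz Ht H. pose proof (Cmod_ge_0 z) as Pz.
  assert (E : Cmod (t * z)%C = t * Cmod z) by (apply Cmod_ray; lra).
  apply ray_slope_bound with t; [exact Hb|lra|].
  pose proof (subordinate_phi0_bound _ (t * z)%C H ltac:(rewrite E; nra)) as B.
  cbv beta in B. rewrite E in B.
  replace (1 + beta * (t * z * q (t * z)) - 1)%C with (beta * (t * z * q (t * z)%C))%C in B by ring.
  rewrite !Cmod_mult, !Cmod_R, !Rabs_right in B by lra. lra.
Qed.

(** Strict because [r < 1]. This yields the open disk of radius 2/3 even when [beta] equals its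
    bound. *)
Lemma majorant_ray_bound (beta r s : R) :
  0 < beta -> 0 <= r < 1 -> 0 <= s <= 1 ->
  majorant (s * r) / beta - majorant (0 * r) / beta < majorant 1 / beta.
Proof.
  intros Hb Hr Hs. rewrite Rmult_0_l, majorant_0, Rdiv_0_l, Rminus_0_r.
  apply Rmult_lt_compat_r; [now apply Rinv_0_lt_compat|].
  apply majorant_lt; [|lra]. split; [nra|nra].
Qed.

Lemma Rdiv_le_of_le_mult (a b c : R) : 0 < b -> a <= c * b -> a / b <= c.
Proof.
  intros Hb H. apply Rmult_le_reg_r with b; [exact Hb|].
  unfold Rdiv. rewrite Rmult_assoc, Rinv_l by lra. lra.
Qed.

Lemma ray_in_disk (t : R) (z : C) : 0 <= t <= 1 -> Cmod z < 1 -> Cmod (t * z)%C < 1.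
Proof. intros Ht Hz. rewrite Cmod_ray by lra. pose proof (Cmod_ge_0 z). nra. Qed.

Lemma ray_scale_le_1 (t : R) (z : C) : 0 <= t <= 1 -> Cmod z < 1 -> t * Cmod z <= 1.
Proof. intros Ht Hz. pose proof (ray_in_disk t z Ht Hz) as H. rewrite Cmod_ray in H; lra. Qed.

Lemma implication_a (p : C -> C) (beta : R) (z : C) :
  analytic_disk p -> p (RtoC 0) = RtoC 1 -> beta >= beta_a ->
  subordinate (lhs_a beta p) phi0 -> Cmod z < 1 -> Cmod (p z - 1)%C < 2 / 3.
Proof.
  intros Hp P0 Hb H Hz. rewrite beta_a_majorant in Hb. pose proof majorant_1_pos as M1.
  pose proof (Cmod_ge_0 z) as Pz. assert (B0 : 0 < beta) by lra.
  pose proof (ray_increment p (C_derive p) z (fun t => majorant (t * Cmod z) / beta)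
    (fun t => Cmod z * majorant' (t * Cmod z) / beta) 1 Rle_0_1
    (fun t Ht => analytic_derive p _ Hp (ray_in_disk t z Ht Hz))
    (fun t Ht => is_derive_majorant_ray beta (Cmod z) t B0 (ray_scale_le_1 t z Ht Hz))) as I.
  cbv beta in I. replace (1%R * z)%C with z in I by ring. rewrite P0 in I.
  eapply Rle_lt_trans; [apply I|].
  - intros t Ht. apply subordinate_lhs_slope; [exact p|exact B0|exact Hz|lra|exact H].
  - eapply Rlt_le_trans; [apply majorant_ray_bound; lra|].
    apply Rdiv_le_of_le_mult; lra.
Qed.

Lemma is_cderive_recip (p : C -> C) (y l : C) :
  p y <> 0%C -> is_cderive p y l -> is_cderive (fun x => / p x)%C y (- (l / p y ^ 2))%C.
Proof.
  intros N H. eapply is_cderive_eq.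
  - apply is_cderive_comp; [apply is_cderive_inv; exact N|exact H].
  - simpl. field. exact N.
Qed.

Lemma lhs_b_slope (p : C -> C) (beta : R) (z : C) (t : R) :
  0 < beta -> subordinate (lhs_b beta p) phi0 -> Cmod z < 1 -> 0 < t <= 1 ->
  p (t * z)%C <> 0%C ->
  Cmod z * Cmod (C_derive p (t * z)%C) <=
    Cmod z * majorant' (t * Cmod z) / beta * Cmod (p (t * z)%C).
Proof.
  intros Hb H Hz Ht N. pose proof (Cmod_neq_0 _ N) as N'.
  pose proof (subordinate_lhs_slope p (fun y => C_derive p y / p y)%C beta z t Hb Hz Ht) as S.
  cbv beta in S. rewrite Cmod_div in S by exact N.
  assert (E : Cmod z * Cmod (C_derive p (t * z)%C) =
    Cmod z * (Cmod (C_derive p (t * z)%C) / Cmod (p (t * z)%C)) * Cmod (p (t * z)%C))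
    by (field; lra).
  rewrite E. apply Rmult_le_compat_r; [lra|]. apply S.
  destruct H as (H1 & H2 & w & H3 & H4 & H5 & H6).
  assert (EE : forall y, lhs_b beta p y = (1 + beta * (y * (C_derive p y / p y)))%C)
    by (intros y; unfold lhs_b, Cdiv; ring).
  split; [|split; [exact H2|exists w; repeat split; try assumption]].
  - intros y Hy. destruct (H1 y Hy) as [l Hl]. exists l.
    apply (is_cderive_ext_loc (lhs_b beta p) _ y l 1); [lra|intros; apply EE|exact Hl].
  - intros y Hy. rewrite <- EE. now apply H6.
Qed.

Lemma lhs_c_slope (p : C -> C) (beta : R) (z : C) (t : R) :
  0 < beta -> subordinate (lhs_c beta p) phi0 -> Cmod z < 1 -> 0 < t <= 1 ->
  p (t * z)%C <> 0%C ->
  Cmod z * Cmod (- (C_derive p (t * z) / p (t * z) ^ 2))%C <=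
    Cmod z * majorant' (t * Cmod z) / beta.
Proof.
  intros Hb H Hz Ht N. rewrite Cmod_opp.
  apply (subordinate_lhs_slope p (fun y => C_derive p y / p y ^ 2)%C beta z t Hb Hz Ht).
  destruct H as (H1 & H2 & w & H3 & H4 & H5 & H6).
  assert (EE : forall y, lhs_c beta p y = (1 + beta * (y * (C_derive p y / p y ^ 2)))%C)
    by (intros y; unfold lhs_c, Cdiv; ring).
  split; [|split; [exact H2|exists w; repeat split; try assumption]].
  - intros y Hy. destruct (H1 y Hy) as [l Hl]. exists l.
    apply (is_cderive_ext_loc (lhs_c beta p) _ y l 1); [lra|intros; apply EE|exact Hl].
  - intros y Hy. rewrite <- EE. now apply H6.
Qed.

Lemma ray_bounds_below (p : C -> C) (t c : R) (z : C) :
  0 < c -> (forall s, 0 <= s < t -> p (s * z)%C <> 0%C) ->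
  (forall s, 0 <= s < t -> Cmod (/ p (s * z))%C <= / c) ->
  forall s, 0 <= s < t -> c <= Cmod (p (s * z)%C).
Proof.
  intros Hc N B s Hs. specialize (N s Hs). specialize (B s Hs).
  rewrite Cmod_inv in B by exact N. apply Cmod_neq_0 in N.
  rewrite <- (Rinv_inv c), <- (Rinv_inv (Cmod _)).
  apply Rinv_le_contravar; [now apply Rinv_0_lt_compat|exact B].
Qed.

(** No logarithm of [p] is taken. The growth bound [|p| <= exp g] turns the estimate
    [|p' / p| <= g'] into [|p'| <= (exp g)'], which is then integrated. *)
Lemma implication_b (p : C -> C) (beta : R) (z : C) :
  analytic_disk p -> p (RtoC 0) = RtoC 1 -> beta >= beta_b ->
  subordinate (lhs_b beta p) phi0 -> Cmod z < 1 -> Cmod (p z - 1)%C < 2 / 3.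
Proof.
  intros Hp P0 Hb H Hz. rewrite beta_b_majorant in Hb. pose proof majorant_1_pos as M1.
  pose proof (Cmod_ge_0 z) as Pz.
  assert (L : 0 < ln (5 / 3)) by (rewrite <- ln_1; apply ln_increasing; lra).
  assert (B0 : 0 < beta).
  { assert (0 < majorant 1 / ln (5 / 3)) by (apply Rdiv_lt_0_compat; lra). lra. }
  assert (BL : majorant 1 / beta <= ln (5 / 3)).
  { apply Rdiv_le_of_le_mult; [exact B0|]. apply Rge_le in Hb.
    apply Rmult_le_compat_r with (r := ln (5 / 3)) in Hb; [|lra].
    unfold Rdiv in Hb. rewrite Rmult_assoc, Rinv_l in Hb by lra. lra. }
  set (g := fun t => majorant (t * Cmod z) / beta).
  set (g' := fun t => Cmod z * majorant' (t * Cmod z) / beta).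
  assert (Dg : forall t, 0 <= t <= 1 -> is_derive g t (g' t)).
  { intros t Ht. apply is_derive_majorant_ray; [exact B0|now apply ray_scale_le_1]. }
  assert (Dp : forall t, 0 <= t <= 1 -> is_cderive p (t * z)%C (C_derive p (t * z)%C)).
  { intros t Ht. apply analytic_derive; [exact Hp|now apply ray_in_disk]. }
  assert (N : forall t, 0 <= t <= 1 -> p (t * z)%C <> 0%C).
  { apply nonvanishing_on_ray.
    - intros t Ht. eexists. apply Dp, Ht.
    - rewrite P0. apply RtoC_neq_0. lra.
    (* The reciprocal of [p] obeys the same growth inequality as [p], so
       [|1 / p| <= exp (g s - g 0)] holds before a first zero. *)
    - intros t Ht N. exists (/ exp (majorant 1 / beta)).
      split; [apply Rinv_0_lt_compat, exp_pos|].
      apply ray_bounds_below; [apply Rinv_0_lt_compat, exp_pos|exact N|].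
      intros s Hs. rewrite Rinv_inv.
      apply Rle_trans with (exp (g s - g 0)).
      + apply (ray_growth (fun y => / p y)%C (fun y => - (C_derive p y / p y ^ 2))%C z g g');
          [lra| |intros; apply Dg; lra| |].
        * intros u Hu. apply is_cderive_recip; [apply N; lra|apply Dp; lra].
        * rewrite P0. field.
        * intros u Hu. assert (Nu : p (u * z)%C <> 0%C) by (apply N; lra).
          pose proof (lhs_b_slope p beta z u B0 H Hz ltac:(lra) Nu) as S. fold (g' u) in S.
          pose proof (Cmod_neq_0 _ Nu) as Nu'.
          rewrite Cmod_opp, Cmod_div, Cmod_pow, Cmod_inv
            by (try exact Nu; simpl; rewrite Cmult_1_r; now apply Cmult_neq_0).
          set (m := Cmod (p (u * z)%C)) in *.
          apply Rmult_le_reg_r with (m * m); [nra|].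
          replace (g' u * / m * (m * m)) with (g' u * m) by (field; lra).
          replace (Cmod z * (Cmod (C_derive p (u * z)%C) / m ^ 2) * (m * m))
            with (Cmod z * Cmod (C_derive p (u * z)%C)) by (field; lra).
          exact S.
      + left. apply exp_increasing. apply majorant_ray_bound; lra. }
  assert (G : forall t, 0 <= t <= 1 -> Cmod (p (t * z)%C) <= exp (g t - g 0)).
  { intros t Ht. apply (ray_growth p (C_derive p) z g g'); [lra| | |exact P0|].
    - intros u Hu. apply Dp. lra.
    - intros u Hu. apply Dg. lra.
    - intros u Hu. apply lhs_b_slope; try assumption; [lra|]. apply N. lra. }
  assert (G0 : g 0 = 0) by (unfold g; rewrite Rmult_0_l, majorant_0; apply Rdiv_0_l).
  pose proof (ray_increment p (C_derive p) z (fun t => exp (g t)) (fun t => g' t * exp (g t))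
    1 Rle_0_1 Dp) as I.
  cbv beta in I. replace (1%R * z)%C with z in I by ring. rewrite P0, G0, exp_0 in I.
  eapply Rle_lt_trans; [apply I|].
  - intros t Ht. apply (is_derive_comp exp g); [|now apply Dg]. apply is_derive_exp.
  - intros t Ht. eapply Rle_trans; [apply lhs_b_slope; try eassumption; [lra|apply N; lra]|].
    fold (g' t). apply Rmult_le_compat_l.
    + unfold g'. pose proof (majorant'_pos (t * Cmod z)) as Q.
      apply Rmult_le_pos; [|left; now apply Rinv_0_lt_compat].
      apply Rmult_le_pos; [exact Pz|]. left. apply Q. nra.
    + specialize (G t ltac:(lra)). rewrite G0, Rminus_0_r in G. exact G.
  - assert (Q : g 1 < ln (5 / 3)).
    { eapply Rlt_le_trans; [|exact BL]. pose proof (majorant_ray_bound beta (Cmod z) 1 B0 ltac:(lra) ltac:(lra)) as Q.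
      fold (g 1) (g 0) in Q. rewrite G0 in Q. lra. }
    apply exp_increasing in Q. rewrite exp_ln in Q by lra. lra.
Qed.

Lemma implication_c (p : C -> C) (beta : R) (z : C) :
  analytic_disk p -> p (RtoC 0) = RtoC 1 -> beta >= beta_c ->
  subordinate (lhs_c beta p) phi0 -> Cmod z < 1 -> Cmod (p z - 1)%C < 2 / 3.
Proof.
  intros Hp P0 Hb H Hz. rewrite beta_c_majorant in Hb. pose proof majorant_1_pos as M1.
  pose proof (Cmod_ge_0 z) as Pz. assert (B0 : 0 < beta) by lra.
  assert (BL : majorant 1 / beta <= 2 / 5) by (apply Rdiv_le_of_le_mult; lra).
  assert (Dp : forall t, 0 <= t <= 1 -> is_cderive p (t * z)%C (C_derive p (t * z)%C)).
  { intros t Ht. apply analytic_derive; [exact Hp|now apply ray_in_disk]. }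
  (* Stated for an initial piece of the ray, so that it can be used before the absence of zeros is
     known, and to prove it. *)
  assert (K : forall s, 0 <= s <= 1 -> (forall u, 0 <= u <= s -> p (u * z)%C <> 0%C) ->
    Cmod (/ p (s * z) - 1)%C < 2 / 5).
  { intros s Hs N.
    pose proof (ray_increment (fun y => / p y)%C (fun y => - (C_derive p y / p y ^ 2))%C z
      (fun t => majorant (t * Cmod z) / beta) (fun t => Cmod z * majorant' (t * Cmod z) / beta)
      s (proj1 Hs)) as I.
    cbv beta in I. rewrite P0 in I. replace (/ 1)%C with (RtoC 1) in I by field.
    eapply Rle_lt_trans; [apply I|].
    - intros u Hu. apply is_cderive_recip; [apply N; lra|apply Dp; lra].
    - intros u Hu. apply is_derive_majorant_ray; [exact B0|apply ray_scale_le_1; [lra|exact Hz]].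
    - intros u Hu. apply lhs_c_slope; try assumption; [lra|apply N; lra].
    - eapply Rlt_le_trans; [apply majorant_ray_bound; lra|exact BL]. }
  assert (N : forall t, 0 <= t <= 1 -> p (t * z)%C <> 0%C).
  { apply nonvanishing_on_ray.
    - intros t Ht. eexists. apply Dp, Ht.
    - rewrite P0. apply RtoC_neq_0. lra.
    (* Before a zero [|1 / p| < 1 + 2/5 < 2]. *)
    - intros t Ht N. exists (/ 2). split; [lra|].
      apply ray_bounds_below; [lra|exact N|].
      intros s Hs. rewrite Rinv_inv.
      specialize (K s ltac:(lra) ltac:(intros; apply N; lra)).
      pose proof (Cmod_minus_le (/ p (s * z)) 1)%C as M. rewrite Cmod_1 in M. lra. }
  specialize (K 1 ltac:(lra) N). specialize (N 1 ltac:(lra)).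
  replace (1%R * z)%C with z in K, N by ring.
  pose proof (Cmod_neq_0 _ N) as N'.
  pose proof (Cmod_minus_le 1 (1 - / p z))%C as M.
  replace (1 - (1 - / p z))%C with (/ p z)%C in M by ring.
  rewrite (Cmod_minus_sym 1 (/ p z)), Cmod_1, Cmod_inv in M by exact N.
  (* From [|1 / p - 1| < 2/5] follow [|1 / p| > 3/5], hence [|p| < 5/3], and
     [|p - 1| = |1 / p - 1| |p| < 2/3]. *)
  replace (p z - 1)%C with (- ((/ p z - 1) * p z))%C by (field; exact N).
  rewrite Cmod_opp, Cmod_mult. set (m := Cmod (p z)) in *.
  assert (m < 5 / 3).
  { apply Rmult_lt_reg_l with (/ m); [now apply Rinv_0_lt_compat|]. rewrite Rinv_l by lra. lra. }
  nra.
Qed.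

(** * Extremal functions *)

(* The principal branch of [- log (1 - z / k0)]; the real part of [1 - z / k0]
   is positive on the disk. *)
Definition neg_log (z : C) : C :=
  (- (ln ((1 - fst z / k0) * (1 - fst z / k0) + snd z / k0 * (snd z / k0)) / 2),
   - atan (- (snd z / k0) / (1 - fst z / k0))).

Lemma one_minus_div_k0_pos (x : R) : x < 1 -> 0 < 1 - x / k0.
Proof.
  intros Hx. pose proof k0_gt_2. apply Rmult_lt_reg_r with k0; [lra|]. unfold Rdiv.
  rewrite Rmult_minus_distr_r, Rmult_assoc, Rinv_l; lra.
Qed.

Lemma neg_log_directional (z h : C) (t : R) :
  Cmod (z + t * h)%C < 1 ->
  is_curve_derive (fun s => neg_log (z + s * h)%C) t (h * / (k0 - (z + t * h)))%C.
Proof.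
  intros B. pose proof k0_gt_2 as K.
  pose proof (fst_le_Cmod (z + t * h)%C) as F. apply Rabs_le_between in F.
  pose proof (one_minus_div_k0_pos (fst (z + t * h)%C) ltac:(lra)) as A.
  pose proof (k0_minus_neq_0 _ B) as N.
  simpl in A, F.
  assert (E1 : fst z + (t * fst h - 0 * snd h) = fst z + t * fst h) by ring.
  rewrite E1 in A, F.
  set (a := fst z + t * fst h) in *. set (b := snd z + t * snd h) in *.
  assert (E2 : (k0 - (z + t * h))%C = (k0 - a, - b)).
  { unfold a, b, RtoC, Cminus, Cplus, Copp, Cmult; simpl. f_equal; ring. }
  assert (Hka : 0 < k0 - a) by lra.
  assert (S1 : 0 < (1 - a / k0) * (1 - a / k0) + b / k0 * (b / k0)).
  { assert (0 < (1 - a / k0) * (1 - a / k0)) by now apply Rmult_lt_0_compat.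
    pose proof (Rle_0_sqr (b / k0)) as Q. unfold Rsqr in Q. lra. }
  assert (S2 : 0 < (k0 - a) ^ 2 + b ^ 2) by nra.
  rewrite E2.
  split.
  - apply (is_derive_ext (fun s : R =>
      - (ln ((1 - (fst z + s * fst h) / k0) * (1 - (fst z + s * fst h) / k0)
        + (snd z + s * snd h) / k0 * ((snd z + s * snd h) / k0)) / 2))).
    { intros s. unfold neg_log; simpl.
      replace (fst z + (s * fst h - 0 * snd h)) with (fst z + s * fst h) by ring.
      replace (snd z + (s * snd h + 0 * fst h)) with (snd z + s * snd h) by ring.
      reflexivity. }
    auto_derive.
    + fold a b. unfold Rdiv, Rminus in S1. lra.
    + fold a b. unfold RtoC, Cinv, Cmult; simpl. field.
      repeat split; try lra; nra.
  - apply (is_derive_ext (fun s : R =>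
      - atan (- ((snd z + s * snd h) / k0) / (1 - (fst z + s * fst h) / k0)))).
    { intros s. unfold neg_log; simpl.
      replace (fst z + (s * fst h - 0 * snd h)) with (fst z + s * fst h) by ring.
      replace (snd z + (s * snd h + 0 * fst h)) with (snd z + s * snd h) by ring.
      reflexivity. }
    auto_derive.
    + fold a. unfold Rdiv, Rminus in A. lra.
    + fold a b. unfold RtoC, Cinv, Cmult; simpl. field.
      repeat split; try lra; nra.
Qed.

Lemma is_cderive_neg_log (z : C) : Cmod z < 1 -> is_cderive neg_log z (/ (k0 - z))%C.
Proof.
  intros Hz.
  apply (is_cderive_of_directional neg_log (fun y => / (k0 - y))%C z (1 - Cmod z)); [lra| |].
  - intros h t Hh Ht. apply neg_log_directional.
    pose proof (Cmod_triangle z (t * h)%C) as T.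
    rewrite Cmod_mult, Cmod_R, Rabs_right in T by lra. pose proof (Cmod_ge_0 h). nra.
  - eapply (cderive_continuous (fun y => / (k0 - y))%C z).
    apply (is_cderive_comp Cinv (fun y => k0 - y)%C);
      [apply is_cderive_inv; now apply k0_minus_neq_0|].
    apply is_cderive_minus; [apply is_cderive_const|apply is_cderive_id].
Qed.

(** The holomorphic extension of [majorant] to the disk: the primitive of [(phi0 z - 1) / z] that
    vanishes at [0]. *)
Definition cmajorant (z : C) : C := (2 * neg_log z - z / k0)%C.

Definition cmajorant' (z : C) : C := ((k0 + z) / (k0 * (k0 - z)))%C.

Lemma is_cderive_cmajorant (z : C) :
  Cmod z < 1 -> is_cderive cmajorant z (cmajorant' z).
Proof.
  intros Hz. pose proof k0_gt_2 as K.
  assert (Nk : RtoC k0 <> 0%C) by (apply RtoC_neq_0; lra).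
  pose proof (k0_minus_neq_0 _ Hz) as Nz.
  eapply is_cderive_eq.
  - apply is_cderive_minus.
    + apply is_cderive_mult; [apply is_cderive_const|now apply is_cderive_neg_log].
    + apply is_cderive_div; [exact Nk|apply is_cderive_id|apply is_cderive_const].
  - unfold cmajorant'. simpl. field. split; assumption.
Qed.

Lemma cmajorant_RtoC (x : R) : x < 1 -> cmajorant (RtoC x) = RtoC (majorant x).
Proof.
  intros Hx. pose proof (one_minus_div_k0_pos x Hx) as A. pose proof k0_gt_2 as K.
  assert (E : neg_log (RtoC x) = RtoC (- ln (1 - x / k0))).
  { unfold neg_log, RtoC; simpl. f_equal.
    - rewrite Rdiv_0_l, Rmult_0_l, Rplus_0_r, ln_mult by exact A. field.
    - rewrite Rdiv_0_l, Ropp_0, Rdiv_0_l, atan_0. ring. }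
  unfold cmajorant, majorant. rewrite E. rewrite <- RtoC_div, <- RtoC_mult, <- RtoC_minus by lra.
  f_equal. ring.
Qed.

Lemma cmajorant_0 : cmajorant 0%C = 0%C.
Proof. rewrite cmajorant_RtoC, majorant_0 by lra. reflexivity. Qed.

(** Keeps the denominator of the extremal function in (c) away from [0]. *)
Lemma Cmod_cmajorant_lt (z : C) : Cmod z < 1 -> Cmod (cmajorant z) < majorant 1.
Proof.
  intros Hz. pose proof (Cmod_ge_0 z) as Pz.
  pose proof (ray_increment cmajorant cmajorant' z (fun t => majorant (t * Cmod z) / 1)
    (fun t => Cmod z * majorant' (t * Cmod z) / 1) 1 Rle_0_1
    (fun t Ht => is_cderive_cmajorant _ (ray_in_disk t z Ht Hz))
    (fun t Ht => is_derive_majorant_ray 1 (Cmod z) t Rlt_0_1 (ray_scale_le_1 t z Ht Hz))) as I.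
  cbv beta in I. replace (1%R * z)%C with z in I by ring.
  rewrite cmajorant_0 in I. replace (cmajorant z - 0)%C with (cmajorant z) in I by ring.
  eapply Rle_lt_trans; [apply I|].
  - intros t Ht. rewrite Rdiv_1_r. apply Rmult_le_compat_l; [exact Pz|].
    apply Cmod_majorant'_le; [rewrite Cmod_ray; lra|apply ray_scale_le_1; [lra|exact Hz]].
  - eapply Rlt_le_trans; [apply majorant_ray_bound; lra|]. lra.
Qed.

Lemma majorant_near_1 (c : R) : c < majorant 1 -> exists x, 0 < x < 1 /\ c < majorant x.
Proof.
  intros Hc.
  assert (Co : continuity_pt majorant 1).
  { apply derivable_continuous_pt. eexists. apply is_derive_Reals, is_derive_majorant. lra. }
  destruct (Co (majorant 1 - c) ltac:(lra)) as (d & Hd & B).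
  exists (1 - Rmin (1 / 2) (d / 2)).
  pose proof (Rmin_l (1 / 2) (d / 2)) as M1. pose proof (Rmin_r (1 / 2) (d / 2)) as M2.
  assert (M : 0 < Rmin (1 / 2) (d / 2)) by (apply Rmin_pos; lra).
  set (m := Rmin (1 / 2) (d / 2)) in *.
  split; [lra|].
  assert (Q : Rabs (majorant (1 - m) - majorant 1) < majorant 1 - c).
  { apply B. split; [split; [exact I|lra]|]. simpl. unfold Rdist. apply Rabs_def1; lra. }
  apply Rabs_def2 in Q. lra.
Qed.

(** For [o = x + i y] the imaginary part of [phiNe o] is [y (1 - x^2 + y^2 / 3)], whose second
    factor is positive in the disk; so a real value forces [y = 0]. Then [5/3 - phiNe x = (1 - x)^2
    (x + 2) / 3 > 0]. *)
Lemma phiNe_real_lt (o : C) (v : R) : Cmod o < 1 -> phiNe o = RtoC v -> v < 5 / 3.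
Proof.
  intros Ho E. destruct o as [x y].
  pose proof (Cmod_sqr (x, y)) as S. simpl in S. pose proof (Cmod_ge_0 (x, y)) as P.
  assert (D : x * x + y * y < 1) by nra.
  assert (E' : phiNe (x, y) = (1 + x - (x * x * x - 3 * x * y * y) / 3,
    y * (1 - x * x + y * y / 3))).
  { unfold phiNe.
    transitivity (1 + (x, y) - (x, y) * (x, y) * (x, y) * RtoC (/ 3))%C.
    - rewrite RtoC_inv by lra. field.
    - unfold RtoC, Cminus, Cplus, Copp, Cmult; simpl. f_equal; field. }
  rewrite E' in E. injection E as Ex Ey.
  assert (Hy : y = 0).
  { apply Rmult_integral in Ey. destruct Ey as [|Ey]; [assumption|exfalso]. nra. }
  subst y. assert (Hx : -1 < x < 1) by (split; nra).
  assert (0 < (1 - x) * (1 - x) * (x + 2)) by (repeat apply Rmult_lt_0_compat; lra).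
  nra.
Qed.

Lemma not_subordinate_phiNe (p : C -> C) (x v : R) :
  0 < x < 1 -> p (RtoC x) = RtoC v -> 5 / 3 <= v -> ~ subordinate p phiNe.
Proof.
  intros Hx E Hv (_ & _ & w & _ & _ & B & H).
  assert (Dx : Cmod (RtoC x) < 1) by (rewrite Cmod_R, Rabs_right; lra).
  specialize (H _ Dx). rewrite E in H.
  pose proof (phiNe_real_lt (w (RtoC x)) v (B _ Dx) (eq_sym H)). lra.
Qed.

Lemma analytic_phi0 : analytic_disk phi0.
Proof.
  intros z Hz. pose proof k0_gt_2 as K.
  assert (Nk : RtoC k0 <> 0%C) by (apply RtoC_neq_0; lra).
  eexists. unfold phi0. apply is_cderive_plus; [apply is_cderive_const|].
  apply is_cderive_mult.
  - apply is_cderive_div; [exact Nk|apply is_cderive_id|apply is_cderive_const].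
  - apply is_cderive_div; [now apply k0_minus_neq_0| |].
    + apply is_cderive_plus; [apply is_cderive_const|apply is_cderive_id].
    + apply is_cderive_minus; [apply is_cderive_const|apply is_cderive_id].
Qed.

Lemma subordinate_phi0_of_eq (f : C -> C) :
  (forall z, Cmod z < 1 -> f z = (1 + z * cmajorant' z)%C) -> subordinate f phi0.
Proof.
  intros H.
  assert (E : forall z, Cmod z < 1 -> phi0 z = f z).
  { intros z Hz. rewrite H, phi0_eq by exact Hz. reflexivity. }
  split; [|split; [exact analytic_phi0|exists (fun z => z); repeat split]].
  - intros z Hz. destruct (analytic_phi0 z Hz) as [l Hl]. exists l.
    apply (is_cderive_ext_loc phi0 f z l (1 - Cmod z)); [unfold unit_disk in Hz; lra| |exact Hl].
    intros y Hy. apply E. pose proof (Cmod_triangle (y - z) z)%C as T.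
    replace (y - z + z)%C with y in T by ring. lra.
  - intros z Hz. exists (RtoC 1). apply is_cderive_id.
  - intros z Hz. exact Hz.
  - intros z Hz. symmetry. now apply E.
Qed.

(** An extremal [p] makes the left-hand side equal to [phi0] on the disk, which is subordinate to
    itself through the identity. With the derivative [p'] supplied, only algebra and a value at one
    real point remain for each case. *)
Lemma best_possible_of_extremal (lhs : R -> (C -> C) -> C -> C) (b0 : R) :
  (forall b, b < b0 -> exists (beta : R) (p p' : C -> C) (x v : R),
     b <= beta /\
     (forall z, Cmod z < 1 -> is_cderive p z (p' z)) /\ p 0%C = 1%C /\
     (forall z, Cmod z < 1 -> C_derive p z = p' z -> lhs beta p z = (1 + z * cmajorant' z)%C) /\
     0 < x < 1 /\ p (RtoC x) = RtoC v /\ 5 / 3 <= v) ->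
  best_possible lhs b0.
Proof.
  intros H b Hb V.
  destruct (H b Hb) as (beta & p & p' & x & v & B & D & P0 & E & Hx & Ev & Hv).
  apply (not_subordinate_phiNe p x v Hx Ev Hv). apply (V p beta); [|exact P0|exact B|].
  - intros z Hz. exists (p' z). now apply D.
  - apply subordinate_phi0_of_eq. intros z Hz. apply E; [exact Hz|].
    apply is_C_derive_unique. now apply D.
Qed.

Lemma is_cderive_cmajorant_div (beta : R) (z : C) :
  beta <> 0 -> Cmod z < 1 ->
  is_cderive (fun y => cmajorant y / beta)%C z (cmajorant' z / beta)%C.
Proof.
  intros Hb Hz. apply RtoC_neq_0 in Hb. eapply is_cderive_eq.
  - apply is_cderive_div; [exact Hb|now apply is_cderive_cmajorant|apply is_cderive_const].
  - simpl. field. exact Hb.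
Qed.

Lemma best_possible_a : best_possible lhs_a beta_a.
Proof.
  apply best_possible_of_extremal. intros b Hb. rewrite beta_a_majorant in Hb.
  (* [b] may be negative or zero. The maximum gives a positive [beta] that is still below the
     bound. *)
  pose proof majorant_1_pos as M1. set (beta := Rmax b (majorant 1)).
  pose proof (Rmax_l b (majorant 1)) as Q1. pose proof (Rmax_r b (majorant 1)) as Q2.
  fold beta in Q1, Q2.
  assert (Q3 : beta < 3 / 2 * majorant 1) by (apply Rmax_lub_lt; lra).
  assert (Nb : RtoC beta <> 0%C) by (apply RtoC_neq_0; lra).
  destruct (majorant_near_1 (2 / 3 * beta) ltac:(lra)) as (x & Hx & Mx).
  exists beta, (fun z => 1 + cmajorant z / beta)%C, (fun z => 0 + cmajorant' z / beta)%C,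
    x, (1 + majorant x / beta).
  split; [exact Q1|]. split; [|split; [|split; [|split; [exact Hx|split]]]].
  - intros z Hz. apply is_cderive_plus; [apply is_cderive_const|].
    apply is_cderive_cmajorant_div; [lra|exact Hz].
  - rewrite cmajorant_0. field. exact Nb.
  - intros z Hz E. unfold lhs_a. rewrite E. field. exact Nb.
  - rewrite cmajorant_RtoC by lra. now rewrite RtoC_plus, RtoC_div by lra.
  - assert (2 / 3 <= majorant x / beta); [|lra].
    apply Rmult_le_reg_r with beta; [lra|]. unfold Rdiv at 2.
    rewrite Rmult_assoc, Rinv_l; lra.
Qed.

Lemma best_possible_b : best_possible lhs_b beta_b.
Proof.
  apply best_possible_of_extremal. intros b Hb. rewrite beta_b_majorant in Hb.
  pose proof majorant_1_pos as M1. set (beta := Rmax b (majorant 1)).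
  pose proof (Rmax_l b (majorant 1)) as Q1. pose proof (Rmax_r b (majorant 1)) as Q2.
  fold beta in Q1, Q2.
  assert (L0 : 0 < ln (5 / 3)) by (rewrite <- ln_1; apply ln_increasing; lra).
  (* This places [majorant 1] below [majorant 1 / ln (5 / 3)], so that the maximum stays below the
     bound. *)
  assert (L1 : ln (5 / 3) < 1).
  { rewrite <- (ln_exp 1). apply ln_increasing; [lra|].
    pose proof (exp_ineq1 1 ltac:(lra)). lra. }
  assert (Q3 : ln (5 / 3) * beta < majorant 1).
  { assert (Q : beta < majorant 1 / ln (5 / 3)).
    { apply Rmax_lub_lt; [exact Hb|]. apply Rmult_lt_reg_r with (ln (5 / 3)); [exact L0|].
      unfold Rdiv. rewrite Rmult_assoc, Rinv_l by lra. nra. }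
    apply Rmult_lt_compat_r with (r := ln (5 / 3)) in Q; [|exact L0].
    unfold Rdiv in Q. rewrite Rmult_assoc, Rinv_l in Q by lra. lra. }
  assert (Nb : RtoC beta <> 0%C) by (apply RtoC_neq_0; lra).
  destruct (majorant_near_1 _ Q3) as (x & Hx & Mx).
  exists beta, (fun z => cexp (cmajorant z / beta)%C),
    (fun z => cmajorant' z / beta * cexp (cmajorant z / beta))%C,
    x, (exp (majorant x / beta)).
  split; [exact Q1|]. split; [|split; [|split; [|split; [exact Hx|split]]]].
  - intros z Hz. apply (is_cderive_comp cexp (fun y => cmajorant y / beta)%C);
      [apply is_cderive_cexp|]. apply is_cderive_cmajorant_div; [lra|exact Hz].
  - rewrite cmajorant_0, <- cexp_0. f_equal. field. exact Nb.
  - intros z Hz E. unfold lhs_b. rewrite E. field. split; [exact Nb|apply cexp_neq_0].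
  - rewrite cmajorant_RtoC by lra. rewrite <- cexp_RtoC. now rewrite RtoC_div by lra.
  - rewrite <- (exp_ln (5 / 3)) by lra. left. apply exp_increasing.
    apply Rmult_lt_reg_r with beta; [lra|]. unfold Rdiv at 2.
    rewrite Rmult_assoc, Rinv_l; lra.
Qed.

Lemma best_possible_c : best_possible lhs_c beta_c.
Proof.
  apply best_possible_of_extremal. intros b Hb. rewrite beta_c_majorant in Hb.
  (* The factor 2 lies below 5/2 and gives [|cmajorant / beta| < 1/2] on the disk, so
     [1 / (1 - cmajorant / beta)] has no pole there. *)
  pose proof majorant_1_pos as M1. set (beta := Rmax b (2 * majorant 1)).
  pose proof (Rmax_l b (2 * majorant 1)) as Q1. pose proof (Rmax_r b (2 * majorant 1)) as Q2.
  fold beta in Q1, Q2.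
  assert (Q3 : beta < 5 / 2 * majorant 1) by (apply Rmax_lub_lt; lra).
  assert (Nb : RtoC beta <> 0%C) by (apply RtoC_neq_0; lra).
  destruct (majorant_near_1 (2 / 5 * beta) ltac:(lra)) as (x & Hx & Mx).
  assert (N : forall z, Cmod z < 1 -> (1 - cmajorant z / beta)%C <> 0%C).
  { intros z Hz. apply Cmod_gt_0.
    pose proof (Cmod_minus_le 1%C (cmajorant z / beta)%C) as M.
    rewrite Cmod_1, Cmod_div, Cmod_R, Rabs_right in M by (exact Nb || lra).
    pose proof (Cmod_cmajorant_lt z Hz) as B.
    assert (Cmod (cmajorant z) / beta <= 1 / 2) by (apply Rdiv_le_of_le_mult; lra).
    lra. }
  exists beta, (fun z => / (1 - cmajorant z / beta))%C,
    (fun z => - ((0 - cmajorant' z / beta) / (1 - cmajorant z / beta) ^ 2))%C,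
    x, (/ (1 - majorant x / beta)).
  split; [exact Q1|]. split; [|split; [|split; [|split; [exact Hx|split]]]].
  - intros z Hz. apply (is_cderive_recip (fun z => 1 - cmajorant z / beta)%C); [now apply N|].
    apply is_cderive_minus; [apply is_cderive_const|].
    apply is_cderive_cmajorant_div; [lra|exact Hz].
  - rewrite cmajorant_0. field. exact Nb.
  - intros z Hz E. unfold lhs_c. rewrite E.
    specialize (N z Hz). set (q := (1 - cmajorant z / beta)%C) in *.
    field. split; [exact N|exact Nb].
  - rewrite cmajorant_RtoC by lra.
    assert (Ql : majorant x / beta <= 1 / 2).
    { apply Rdiv_le_of_le_mult; [lra|]. pose proof (majorant_lt x 1 ltac:(lra) ltac:(lra)). lra. }
    now rewrite RtoC_inv, RtoC_minus, RtoC_div by lra.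
  - assert (Ql : majorant x / beta <= 1 / 2).
    { apply Rdiv_le_of_le_mult; [lra|]. pose proof (majorant_lt x 1 ltac:(lra) ltac:(lra)). lra. }
    assert (Qu : 2 / 5 <= majorant x / beta).
    { apply Rmult_le_reg_r with beta; [lra|]. unfold Rdiv at 2.
      rewrite Rmult_assoc, Rinv_l; lra. }
    replace (5 / 3) with (/ (3 / 5)) by field. apply Rinv_le_contravar; lra.
Qed.

Theorem theorem3p3 :
  (forall (p : C -> C) (beta : R),
     analytic_disk p -> p (RtoC 0) = RtoC 1 ->
     (subordinate (lhs_a beta p) phi0 /\ beta >= beta_a) \/
     (subordinate (lhs_b beta p) phi0 /\ beta >= beta_b) \/
     (subordinate (lhs_c beta p) phi0 /\ beta >= beta_c) ->
     subordinate p phiNe)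
  /\ best_possible lhs_a beta_a
  /\ best_possible lhs_b beta_b
  /\ best_possible lhs_c beta_c.
Proof.
  split; [|exact (conj best_possible_a (conj best_possible_b best_possible_c))].
  intros p beta Hp P0 H. apply subordinate_phiNe; [exact Hp|exact P0|].
  intros z Hz. destruct H as [[H Hb]|[[H Hb]|[H Hb]]].
  - now apply implication_a with beta.
  - now apply implication_b with beta.
  - now apply implication_c with beta.
Qed.
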